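(* Let $R$ be a commutative ring, $n\ge1$, and let $I$ be a finitely generated ideal of $R$ such that $\mathrm{Ext}^i_R(R/I,R)=0$ for all $i=0,1,\ldots,n-1$. Then: (i) $S_{I,n}$ is a strongly finitely presented module of projective dimension $n$, (ii) $\bigcap_{i=0}^{n-1}\mathrm{Ker}\,\mathrm{Ext}^i_R(R/I,-)=(S_{I,n})^{\intercal}$, (iii) $\bigcap_{i=0}^{n-1}\mathrm{Ker}\,\mathrm{Ext}^i_R(R/I,-)$ is an $n$-cotilting class of cofinite type.
   Context: $\mathrm{Ker}\,\mathrm{Ext}^i_R(R/I,-)$ is the class of $R$-modules $M$ with $\mathrm{Ext}^i_R(R/I,M)=0$. For a class $\mathcal{S}$ of modules, $\mathcal{S}^{\intercal}=\{M\mid\mathrm{Tor}^R_i(S,M)=0\text{ for all }S\in\mathcal{S},\ i>0\}$; for a single module $S$, $S^{\intercal}=\{S\}^{\intercal}$. For $x\in R$, $K_\bullet(x)$ is the complex $0\to R\xrightarrow{x}R\to0$ in homological degrees $1,0$; for $\mathbf{x}=(x_1,\ldots,x_m)$, $K_\bullet(\mathbf{x})=\bigotimes_iK_\bullet(x_i)$. For each finitely generated ideal $I$ a finite generating sequence $\mathbf{x}$ is fixed and $K_\bullet(I)=K_\bullet(\mathbf{x})$, written $\cdots\to F_k\xrightarrow{d_k}F_{k-1}\to\cdots\xrightarrow{d_1}F_0\to0$ with $F_k$ in degree $k$. With $(-)^*=\mathrm{Hom}_R(-,R)$, for $k\geq 1$ put $S_{I,k}=\mathrm{Coker}(d_k^*\colon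 F_{k-1}^*\to F_k^* )$. A module is strongly finitely presented if it has a finite projective resolution consisting of finitely generated projectives. A module $C$ is $n$-cotilting if its injective dimension is $\le n$; $\mathrm{Ext}^i_R(C^X,C)=0$ for all $i>0$ and all sets $X$; and there is an exact sequence $0\to C_n\to\cdots\to C_0\to W\to0$ with each $C_i$ a direct summand of a direct product of copies of $C$ and $W$ an injective cogenerator of the category of $R$-modules. An $n$-cotilting class is a class of the form $\{M\mid\mathrm{Ext}^i_R(M,C)=0\text{ for all }i>0\}$ with $C$ an $n$-cotilting module. A class is of cofinite type if it equals $\mathcal{S}^\intercal$ for a set $\mathcal{S}$ of strongly finitely presented modules of bounded projective dimension.
   Formalization: In (i), projective dimension exactly n is asserted only for proper I (for I = R only ≤ n): if I = R the Ext hypothesis holds trivially but S_{I,n} is projective, so the dimension cannot be n ≥ 1. *)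

(* Defs.v *)
From HB Require Import structures.
From mathcomp Require Import all_boot all_order all_algebra.
From mathcomp Require Import ring_quotient.
From mathcomp Require Import finmap.
From mathcomp Require Import all_classical.

Set Implicit Arguments.
Unset Strict Implicit.
Unset Printing Implicit Defensive.

Import GRing.Theory.
Local Open Scope classical_set_scope.
Local Open Scope ring_scope.

Section LinearMaps.
Variables (R : comPzRingType).
Implicit Types U V W : lmodType R.

Definition mklin U V (f : U -> V) (fl : linear f) : {linear U -> V} :=
  HB.pack f (GRing.isLinear.Build R U V *:%R f fl).

Lemma scale_by_linear V (a : R) : linear (fun v : V => a *: v).
Proof. by move=> b u v; rewrite scalerDr !scalerA mulrC. Qed.

Definition scale_by V (a : R) : {linear V -> V} := mklin (@scale_by_linear V a).

Definition is_zero V := forall v : V, v = 0.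

Definition surj U V (f : {linear U -> V}) := forall v, exists u, f u = v.

Definition exact_at U V W (f : {linear U -> V}) (g : {linear V -> W}) :=
  forall v, g v = 0 <-> exists u, f u = v.

End LinearMaps.

Section Hom.
Variables (R : comPzRingType) (U V : lmodType R).

Definition linear_pred : {pred U -> V} := fun f => `[< linear f >].

Fact linear_pred_closed : subsemimod_closed linear_pred.
Proof.
split; first split.
- by apply/asboolP => a u v; rewrite -[LHS]/(0 : V) -[0 v]/(0 : V) scaler0 addr0.
- move=> f g /asboolP fl /asboolP gl; apply/asboolP => a u v.
  by rewrite -[LHS]/(f _ + g _) fl gl addrACA -scalerDr.
- move=> b f /asboolP fl; apply/asboolP => a u v.
  by rewrite -[LHS]/(b *: f _) fl scalerDr !scalerA mulrC -scalerA.
Qed.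
HB.instance Definition _ :=
  GRing.isSubmodClosed.Build R (U -> V) linear_pred linear_pred_closed.

Record hom : Type := Hom { hom_fun : U -> V; _ : hom_fun \in linear_pred }.

HB.instance Definition _ := [isSub for hom_fun].
HB.instance Definition _ := [Choice of hom by <:].
HB.instance Definition _ := [SubChoice_isSubLmodule of hom by <:].

Lemma hom_linear (f : hom) : linear (hom_fun f).
Proof. exact/asboolP/(valP f). Qed.

Lemma homP (f : U -> V) : linear f -> f \in linear_pred.
Proof. by move=> fl; apply/asboolP. Qed.

End Hom.

Section Dual.
Variable R : comPzRingType.

Definition dual (V : lmodType R) : lmodType R := hom V R^o.

Variables (U V : lmodType R) (f : {linear U -> V}).

Fact dual_map_subproof (h : dual V) : linear (hom_fun h \o f).
Proof. by move=> a u v; rewrite /= linearP hom_linear. Qed.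

Definition dual_map_fun (h : dual V) : dual U := Hom (homP (dual_map_subproof h)).

Fact dual_map_linear : linear dual_map_fun.
Proof. by move=> a g h; apply: val_inj. Qed.

Definition dual_map : {linear dual V -> dual U} := mklin dual_map_linear.
End Dual.

Section Quotient.
Variables (R : comPzRingType) (V : lmodType R) (S : submodClosed V).

Fact submod_zmod_closed : zmod_closed S.
Proof.
by split=> [|u v Su Sv]; rewrite ?rpred0// -scaleN1r rpredD// rpredZ.
Qed.

Definition submod_zmodClosed : zmodClosed V :=
  HB.pack (S : {pred V}) (GRing.isZmodClosed.Build V (S : {pred V}) submod_zmod_closed).

Definition quotmod : Type := Quotient.quot submod_zmodClosed.
HB.instance Definition _ := GRing.Zmodule.on quotmod.

Definition qproj (v : V) : quotmod := (\pi_(Quotient.quot submod_zmodClosed) v)%qT.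

Definition qrepr (x : quotmod) : V :=
  repr (x : Quotient.quot submod_zmodClosed).

Lemma qreprK : cancel qrepr qproj.
Proof. by move=> x; rewrite /qproj /qrepr reprK. Qed.

Lemma qproj_eq u v : (qproj u = qproj v) <-> (u - v \in S).
Proof.
rewrite -[_ - _ \in _]/(u - v \in submod_zmodClosed) Quotient.idealrBE.
by split=> [/eqP|/eqP].
Qed.

Lemma qprojD u v : qproj (u + v) = qproj u + qproj v.
Proof. exact: raddfD. Qed.

Definition qscale (a : R) (x : quotmod) := qproj (a *: qrepr x).

Lemma qscaleE a v : qscale a (qproj v) = qproj (a *: v).
Proof. by apply/qproj_eq; rewrite -scalerBr rpredZ//; apply/qproj_eq/qreprK. Qed.

Fact qscaleA a b x : qscale a (qscale b x) = qscale (a * b) x.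
Proof. by rewrite -[x]qreprK !qscaleE scalerA. Qed.

Fact qscale1 : left_id 1 qscale.
Proof. by move=> x; rewrite -[x]qreprK qscaleE scale1r. Qed.

Fact qscaleDr : right_distributive qscale +%R.
Proof.
move=> a x y; rewrite -[x]qreprK -[y]qreprK.
by rewrite -qprojD !qscaleE scalerDr qprojD.
Qed.

Fact qscaleDl x : {morph qscale^~ x : a b / a + b}.
Proof. by move=> a b; rewrite -[x]qreprK !qscaleE scalerDl qprojD. Qed.

HB.instance Definition _ := GRing.Zmodule_isLmodule.Build R quotmod
  qscaleA qscale1 qscaleDr qscaleDl.

Lemma qproj_linear : linear qproj.
Proof. by move=> a u v; rewrite qprojD -qscaleE. Qed.

Section Lift.
Variables (W : lmodType R) (f : {linear V -> W}).
Hypothesis fS : forall v, v \in S -> f v = 0.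

Definition quot_lift_fun (x : quotmod) : W := f (qrepr x).

Lemma quot_liftE v : quot_lift_fun (qproj v) = f v.
Proof.
apply/subr0_eq; rewrite -linearB; apply: fS; apply/qproj_eq; exact: qreprK.
Qed.

Fact quot_lift_linear : linear quot_lift_fun.
Proof.
move=> a x y; rewrite -[x]qreprK -[y]qreprK -qproj_linear !quot_liftE.
exact: linearP.
Qed.

Definition quot_lift : {linear quotmod -> W} := mklin quot_lift_linear.
End Lift.
End Quotient.

Section Span.
Variables (R : comPzRingType) (V : lmodType R) (A : set V).

Definition span_pred : {pred V} :=
  fun v => `[< forall S : submodClosed V, (forall u, A u -> u \in S) -> v \in S >].

Fact span_closed : subsemimod_closed span_pred.
Proof.
split; first split.
- by apply/asboolP => S _; rewrite rpred0.
- move=> u v /asboolP Au /asboolP Av; apply/asboolP => S AS.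
  by rewrite rpredD ?Au ?Av.
- move=> a v /asboolP Av; apply/asboolP => S AS.
  by rewrite rpredZ ?Av.
Qed.
HB.instance Definition _ :=
  GRing.isSubmodClosed.Build R V span_pred span_closed.

Lemma span_gen v : A v -> v \in span_pred.
Proof. by move=> Av; apply/asboolP => S; apply. Qed.

End Span.

Definition fin_gen (R : comPzRingType) (V : lmodType R) :=
  exists s : seq V, forall v, v \in span_pred [set` s].

Section Coker.
Variables (R : comPzRingType) (U V : lmodType R) (f : {linear U -> V}).

Definition im_pred : {pred V} := fun v => `[< exists u, f u = v >].

Fact im_closed : subsemimod_closed im_pred.
Proof.
split; first split.
- by apply/asboolP; exists 0; rewrite linear0.
- move=> _ _ /asboolP[u <-] /asboolP[v <-]; apply/asboolP.
  by exists (u + v); rewrite linearD.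
- by move=> a _ /asboolP[v <-]; apply/asboolP; exists (a *: v); rewrite linearZ.
Qed.
HB.instance Definition _ := GRing.isSubmodClosed.Build R V im_pred im_closed.

Definition coker : lmodType R := quotmod im_pred.
End Coker.

Section Kernel.
Variables (R : comPzRingType) (U V : lmodType R) (f : {linear U -> V}).

Definition ker_pred : {pred U} := fun u => `[< f u = 0 >].

Fact ker_closed : subsemimod_closed ker_pred.
Proof.
split; first split.
- by apply/asboolP; rewrite linear0.
- by move=> u v /asboolP u0 /asboolP v0; apply/asboolP; rewrite linearD u0 v0 addr0.
- by move=> a v /asboolP v0; apply/asboolP; rewrite linearZ v0; exact: scaler0.
Qed.
HB.instance Definition _ := GRing.isSubmodClosed.Build R U ker_pred ker_closed.

Record ker : Type := Ker { ker_val : U; _ : ker_val \in ker_pred }.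

HB.instance Definition _ := [isSub for ker_val].
HB.instance Definition _ := [Choice of ker by <:].
HB.instance Definition _ := [SubChoice_isSubLmodule of ker by <:].

Lemma kerP (u : ker) : f (ker_val u) = 0.
Proof. exact/asboolP/(valP u). Qed.

Lemma ker_val_linear : linear ker_val.
Proof. by []. Qed.
End Kernel.

Section Free.
Variables (R : comPzRingType) (X : choiceType).

Definition fsupp_pred : {pred X -> R^o} :=
  fun f => `[< finite_set [set x | f x <> 0] >].

Fact fsupp_closed : subsemimod_closed fsupp_pred.
Proof.
split; first split.
- by apply/asboolP; apply: sub_finite_set (finite_set0 X) => x /=.
- move=> f g /asboolP ff /asboolP fg; apply/asboolP.
  have : finite_set ([set x | f x <> 0] `|` [set x | g x <> 0]).
    by rewrite finite_setU.
  apply: sub_finite_set => x /= fgx.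
  have [fx0|] := eqVneq (f x) 0; last by move/eqP; left.
  by right => gx0; apply: fgx; rewrite -[LHS]/(f x + g x) fx0 gx0 addr0.
- move=> a f /asboolP ff; apply/asboolP.
  apply: sub_finite_set ff => x /= afx fx0; apply: afx.
  by rewrite -[LHS]/(a *: f x) fx0 scaler0.
Qed.
HB.instance Definition _ :=
  GRing.isSubmodClosed.Build R (X -> R^o) fsupp_pred fsupp_closed.

Record free : Type := Free { free_fun : X -> R^o; _ : free_fun \in fsupp_pred }.

HB.instance Definition _ := [isSub for free_fun].
HB.instance Definition _ := [Choice of free by <:].
HB.instance Definition _ := [SubChoice_isSubLmodule of free by <:].

Fact basis_subproof (x : X) :
  (fun y => if y == x then 1 else 0 : R^o) \in fsupp_pred.
Proof.
apply/asboolP; apply: sub_finite_set (finite_set1 x) => y /=.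
by case: eqP.
Qed.

Definition basis (x : X) : free := Free (basis_subproof x).

Lemma free_finite (f : free) : finite_set [set x | free_fun f x <> 0].
Proof. exact/asboolP/(valP f). Qed.

Section Lift.
Variables (V : lmodType R) (phi : X -> V).

Definition free_lift_fun (f : free) : V := \sum_(x \in setT) free_fun f x *: phi x.

Lemma free_lift_seq (s : {fset X}) (f : free) :
  (forall x, free_fun f x <> 0 -> x \in s) ->
  free_lift_fun f = \sum_(x <- s) free_fun f x *: phi x.
Proof.
move=> fs; rewrite /free_lift_fun (fsbigE (enum_fset s))//.
- by apply: eq_bigl => x; rewrite in_setT.
- by move=> x _; apply: contraNeq => fx; apply: fs => fx0; rewrite fx0 scale0r eqxx in fx.
Qed.

Fact free_lift_linear : linear free_lift_fun.
Proof.
move=> a f g.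
pose s := (fset_set [set x | free_fun f x <> 0] `|`
  fset_set [set x | free_fun g x <> 0])%fset.
have sf x : free_fun f x <> 0 -> x \in s.
  by move=> fx; rewrite inE in_fset_set ?mem_set//; exact: free_finite.
have sg x : free_fun g x <> 0 -> x \in s.
  move=> gx; rewrite inE; apply/orP; right.
  by rewrite in_fset_set ?mem_set//; exact: free_finite.
rewrite (free_lift_seq sf) (free_lift_seq sg) (@free_lift_seq s).
  rewrite scaler_sumr -big_split/=; apply: eq_bigr => x _.
  by rewrite scalerA -scalerDl.
move=> x /= fgx; have [fx0|] := eqVneq (free_fun f x) 0; last by move/eqP/sf.
by apply: sg => gx0; apply: fgx;
  rewrite -[LHS]/(a *: free_fun f x + free_fun g x) fx0 gx0 scaler0 addr0.
Qed.

Definition free_lift : {linear free -> V} := mklin free_lift_linear.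

Lemma free_liftE x : free_lift (basis x) = phi x.
Proof.
rewrite /free_lift/= (@free_lift_seq [fset x]%fset).
  by rewrite big_seq_fset1/= eqxx scale1r.
by move=> y /=; rewrite inE; case: eqP.
Qed.
End Lift.

Lemma free_ext (V : lmodType R) (f g : {linear free -> V}) :
  (forall x, f (basis x) = g (basis x)) -> f =1 g.
Proof.
move=> fg h.
pose s := fset_set [set x | free_fun h x <> 0].
have -> : h = \sum_(x <- s) free_fun h x *: basis x.
  apply: val_inj; rewrite raddf_sum/=; apply/funext => y.
  rewrite fct_sumE/= (eq_bigr (fun x => if x == y then free_fun h y else 0)).
    rewrite -big_mkcond/= -big_filter.
    have [hy0|/eqP hy] := eqVneq (free_fun h y) 0.
      by rewrite hy0 big1_seq.
    have ys : y \in s by rewrite in_fset_set ?mem_set//; exact: free_finite.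
    by rewrite filter_pred1_uniq ?fset_uniq// big_seq1.
  move=> x _ /=; rewrite -[LHS]/(free_fun h x * (if y == x then 1 else 0)).
  by rewrite [y == x]eq_sym; case: eqP => [->|]; rewrite ?mulr1 ?mulr0.
by rewrite !linear_sum; apply: eq_bigr => x _; rewrite !linearZ/= fg.
Qed.

End Free.

Section Tensor.
Variables (R : comPzRingType) (M N : lmodType R).

Definition tens_rel : set (free R (M * N)%type) :=
  [set v | [\/ exists m m' n,
                 v = basis R (m + m', n) - basis R (m, n) - basis R (m', n),
               exists m n n',
                 v = basis R (m, n + n') - basis R (m, n) - basis R (m, n'),
               exists a m n, v = basis R (a *: m, n) - a *: basis R (m, n) |
               exists a m n, v = basis R (m, a *: n) - a *: basis R (m, n)]].

Definition tens : lmodType R := quotmod (span_pred tens_rel).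

Definition pure (m : M) (n : N) : tens :=
  qproj (span_pred tens_rel) (basis R (m, n)).

Lemma pure_linear_l n : linear (pure^~ n).
Proof.
move=> a m m'; rewrite /pure -qproj_linear.
have pD u v : qproj (span_pred tens_rel) (basis R (u + v, n)) =
    qproj _ (basis R (u, n) + basis R (v, n)).
  apply/qproj_eq; rewrite opprD addrA; apply: span_gen.
  by constructor 1; exists u, v, n.
rewrite pD; apply/qproj_eq; rewrite opprD addrACA subrr addr0.
by apply: span_gen; constructor 3; exists a, m, n.
Qed.

Lemma pure_linear_r m : linear (pure m).
Proof.
move=> a n n'; rewrite /pure -qproj_linear.
have pD u v : qproj (span_pred tens_rel) (basis R (m, u + v)) =
    qproj _ (basis R (m, u) + basis R (m, v)).
  apply/qproj_eq; rewrite opprD addrA; apply: span_gen.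
  by constructor 2; exists m, u, v.
rewrite pD; apply/qproj_eq; rewrite opprD addrACA subrr addr0.
by apply: span_gen; constructor 4; exists a, m, n.
Qed.

Lemma tens_ext (T : lmodType R) (f g : {linear tens -> T}) :
  (forall m n, f (pure m n) = g (pure m n)) -> f =1 g.
Proof.
move=> fg x; rewrite -[x]qreprK; move: (qrepr x).
pose p := mklin (@qproj_linear _ _ (span_pred tens_rel)).
by apply: (@free_ext _ _ _ (f \o p) (g \o p)) => -[m n]; exact: fg.
Qed.

Section Lift.
Variables (T : lmodType R) (b : M -> N -> T).
Hypotheses (bl : forall n, linear (b^~ n)) (br : forall m, linear (b m)).

Let b0 := free_lift (fun p : M * N => b p.1 p.2).

Let b0E m n : b0 (basis R (m, n)) = b m n. Proof. exact: free_liftE. Qed.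

Fact tens_lift_subproof v : v \in span_pred tens_rel -> b0 v = 0.
Proof.
move=> /asboolP /(_ (ker_pred b0)) H.
apply/asboolP; apply: H => {}v relv; apply/asboolP.
case: relv => [[m [m' [n ->]]]|[m [n [n' ->]]]|[a [m [n ->]]]|[a [m [n ->]]]].
- rewrite !linearB !b0E -[b (m + m') n]/(mklin (bl n) (m + m')).
  by rewrite linearD/= addrAC addrK subrr.
- rewrite !linearB !b0E -[b m (n + n')]/(mklin (br m) (n + n')).
  by rewrite linearD/= addrAC addrK subrr.
- rewrite linearB linearZ !b0E -[b (a *: m) n]/(mklin (bl n) (a *: m)).
  by rewrite linearZ subrr.
- rewrite linearB linearZ !b0E -[b m (a *: n)]/(mklin (br m) (a *: n)).
  by rewrite linearZ subrr.
Qed.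

Definition tens_lift : {linear tens -> T} := quot_lift tens_lift_subproof.

Lemma tens_liftE m n : tens_lift (pure m n) = b m n.
Proof. exact: etrans (quot_liftE tens_lift_subproof _) (b0E m n). Qed.
End Lift.
End Tensor.

Section TensorMap.
Variables (R : comPzRingType).

Section Def.
Variables (M M' N N' : lmodType R) (f : {linear M -> M'}) (g : {linear N -> N'}).

Fact tens_map_linear_l n : linear (fun m => pure (f m) (g n)).
Proof. by move=> a m m'; rewrite linearP pure_linear_l. Qed.

Fact tens_map_linear_r m : linear (fun n => pure (f m) (g n)).
Proof. by move=> a n n'; rewrite linearP pure_linear_r. Qed.

Definition tens_map : {linear tens M N -> tens M' N'} :=
  tens_lift tens_map_linear_l tens_map_linear_r.

Lemma tens_mapE m n : tens_map (pure m n) = pure (f m) (g n).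
Proof. exact: tens_liftE. Qed.
End Def.

Lemma tens_map_comp (M M' M'' N N' N'' : lmodType R)
    (f : {linear M -> M'}) (f' : {linear M' -> M''})
    (g : {linear N -> N'}) (g' : {linear N' -> N''}) x :
  tens_map f' g' (tens_map f g x) = tens_map (f' \o f) (g' \o g) x.
Proof.
apply: (@tens_ext _ _ _ _ (tens_map f' g' \o tens_map f g)) => m n.
by rewrite -[LHS]/(tens_map f' g' (tens_map f g (pure m n))) !tens_mapE.
Qed.

Lemma eq_tens_map (M M' N N' : lmodType R) (f f' : {linear M -> M'})
    (g g' : {linear N -> N'}) :
  f =1 f' -> g =1 g' -> tens_map f g =1 tens_map f' g'.
Proof. by move=> ff gg; apply: tens_ext => m n; rewrite !tens_mapE ff gg. Qed.

Lemma tens_map0r (M M' N N' : lmodType R) (f : {linear M -> M'})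
    (g : {linear N -> N'}) :
  (forall n, g n = 0) -> forall x, tens_map f g x = 0.
Proof.
move=> g0; apply: (@tens_ext _ _ _ _ _ \0) => m n; rewrite tens_mapE g0.
exact: (linear0 (mklin (pure_linear_r (f m)))).
Qed.
End TensorMap.

(* Nonnegatively graded complexes; [cdif C k] is the differential out of
   degree [k.+1] (resp. out of degree [k] for cochain complexes). *)
Record chain (R : comPzRingType) := Chain {
  cobj :> nat -> lmodType R;
  cdif : forall k, {linear cobj k.+1 -> cobj k};
  cdifK : forall k x, cdif k (cdif k.+1 x) = 0
}.

Record cochain (R : comPzRingType) := Cochain {
  ccobj :> nat -> lmodType R;
  ccdif : forall k, {linear ccobj k -> ccobj k.+1};
  ccdifK : forall k x, ccdif k.+1 (ccdif k x) = 0
}.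

Section Homological.
Variable R : comPzRingType.
Implicit Types M N S P E C W : lmodType R.

Definition projective P := forall M N (g : {linear M -> N}) (f : {linear P -> N}),
  surj g -> exists h : {linear P -> M}, forall x, g (h x) = f x.

Definition injective_mod E := forall M N (g : {linear M -> N}) (f : {linear M -> E}),
  injective g -> exists h : {linear N -> E}, forall x, h (g x) = f x.

Definition cogenerator W := forall M N (f : {linear M -> N}),
  (exists x, f x <> 0) -> exists (h : {linear N -> W}) (x : M), h (f x) <> 0.

Definition resolution M (P : chain R) (e : {linear P 0 -> M}) :=
  [/\ surj e, exact_at (cdif P 0) e &
      forall k, exact_at (cdif P k.+1) (cdif P k)].

Definition proj_resolution M (P : chain R) (e : {linear P 0 -> M}) :=
  resolution e /\ forall k, projective (P k).

Definition inj_resolution M (E : cochain R) (e : {linear M -> E 0}) :=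
  [/\ injective e, exact_at e (ccdif E 0),
      forall k, exact_at (ccdif E k) (ccdif E k.+1) &
      forall k, injective_mod (E k)].

Definition projdim_le M n := exists (P : chain R) (e : {linear P 0 -> M}),
  proj_resolution e /\ forall k, (n < k)%N -> is_zero (P k).

(* The zero module gets projective dimension 0. *)
Definition projdim_eq M n :=
  projdim_le M n /\ forall k, (k < n)%N -> ~ projdim_le M k.

Definition injdim_le M n := exists (E : cochain R) (e : {linear M -> E 0}),
  inj_resolution e /\ forall k, (n < k)%N -> is_zero (E k).

Definition strongly_fp M := exists (P : chain R) (e : {linear P 0 -> M}),
  [/\ proj_resolution e, forall k, fin_gen (P k) &
      exists n, forall k, (n < k)%N -> is_zero (P k)].

(* Exactness of the complex [Hom (P, N)] in degree [i]. *)
Definition Hom_exact (P : chain R) N i :=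
  match i with
  | 0 => forall f : {linear P 0 -> N},
      (forall x, f (cdif P 0 x) = 0) -> forall y, f y = 0
  | j.+1 => forall f : {linear P j.+1 -> N},
      (forall x, f (cdif P j.+1 x) = 0) ->
      exists g : {linear P j -> N}, forall y, f y = g (cdif P j y)
  end.

(* Exactness of the complex [P (x) N] in degree [i]. *)
Definition tens_exact (P : chain R) N i :=
  match i with
  | 0 => surj (tens_map (cdif P 0) (idfun : {linear N -> N}))
  | j.+1 => exact_at (tens_map (cdif P j.+1) (idfun : {linear N -> N}))
                     (tens_map (cdif P j) (idfun : {linear N -> N}))
  end.

(* Vanishing of [Ext^i (M, N)] and [Tor_i (M, N)], computed on projective
   resolutions of [M]; one exists by [proj_resolution_exists] below. *)
Definition Ext_eq0 i M N := forall (P : chain R) (e : {linear P 0 -> M}),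
  proj_resolution e -> Hom_exact P N i.

Definition Tor_eq0 i M N := forall (P : chain R) (e : {linear P 0 -> M}),
  proj_resolution e -> tens_exact P N i.

Definition summand_of_power C M := exists (X : Type)
    (i : {linear M -> (X -> C)}) (p : {linear (X -> C) -> M}),
  forall m, p (i m) = m.

Definition cotilting n C :=
  [/\ injdim_le C n,
      forall (X : Type) i, (0 < i)%N -> Ext_eq0 i (X -> C) C &
      exists W (P : chain R) (e : {linear P 0 -> W}),
        [/\ injective_mod W /\ cogenerator W, resolution e,
            forall k, (k <= n)%N -> summand_of_power C (P k) &
            forall k, (n < k)%N -> is_zero (P k)]].

Definition cotilting_class n (K : lmodType R -> Prop) := exists C,
  cotilting n C /\ forall M, K M <-> forall i, (0 < i)%N -> Ext_eq0 i M C.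

Definition Tor_orth (J : Type) (S : J -> lmodType R) M :=
  forall j i, (0 < i)%N -> Tor_eq0 i (S j) M.

(* Strongly finitely presented modules form a set up to isomorphism, so the
   size of the index type [J] is immaterial. *)
Definition cofinite_type (K : lmodType R -> Prop) :=
  exists (J : Type) (S : J -> lmodType R) (d : nat),
    (forall j, strongly_fp (S j) /\ projdim_le (S j) d) /\
    forall M, K M <-> Tor_orth S M.

End Homological.

Section Existence.
Variable R : comPzRingType.

Lemma free_projective (X : choiceType) : projective (free R X).
Proof.
move=> M N g f gs.
have [phi phiE] : {phi : X -> M & forall x, g (phi x) = f (basis R x)}.
  by apply: (@choice _ _ (fun x m => g m = f (basis R x))) => x; exact: gs.
exists (free_lift phi) => x.
apply: (@free_ext _ _ _ (g \o free_lift phi)) => {}x.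
by rewrite -[LHS]/(g (free_lift phi (basis R x))) free_liftE phiE.
Qed.

Definition free_cover (M : lmodType R) : {linear free R M -> M} := free_lift id.

Lemma free_cover_surj M : surj (free_cover M).
Proof. by move=> m; exists (basis R m); exact: free_liftE. Qed.

Fixpoint syzygy (M : lmodType R) k : lmodType R :=
  if k is j.+1 then ker (free_cover (syzygy M j)) else M.

Definition free_res_dif M k :
    {linear free R (syzygy M k.+1) -> free R (syzygy M k)} :=
  mklin (@ker_val_linear _ _ _ (free_cover (syzygy M k)))
    \o free_cover (syzygy M k.+1).

Lemma free_res_exact M k : exact_at (free_res_dif M k) (free_cover (syzygy M k)).
Proof.
move=> v; split=> [v0|[u <-]]; last exact: kerP.
have vk : v \in ker_pred (free_cover (syzygy M k)) by apply/asboolP.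
have [u uE] := @free_cover_surj (syzygy M k.+1) (Ker vk).
by exists u; rewrite -[LHS]/(ker_val (free_cover (syzygy M k.+1) u)) uE.
Qed.

Fact free_res_difK M k x : free_res_dif M k (free_res_dif M k.+1 x) = 0.
Proof.
rewrite -[LHS]/(ker_val (free_cover _ (free_res_dif M k.+1 x))).
by have /(_ (free_res_dif M k.+1 x)) [_ ->] := @free_res_exact M k.+1; last by exists x.
Qed.

Definition free_res M : chain R := Chain (@free_res_difK M).

Lemma proj_resolution_exists (M : lmodType R) :
  exists (P : chain R) (e : {linear P 0 -> M}), proj_resolution e.
Proof.
exists (free_res M), (free_cover M); split; last by move=> k; exact: free_projective.
split; [exact: free_cover_surj|exact: (free_res_exact (k := 0))|move=> k v].
rewrite -(@free_res_exact M k.+1 v); split=> [v0|v0].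
  by apply: val_inj.
by rewrite -[LHS]/(ker_val (free_cover (syzygy M k.+1) v)) v0.
Qed.

End Existence.

Section Koszul.
Variable R : comPzRingType.

(* Tensor product of the complex [0 -> A1 -> A0 -> 0], in degrees 1 and 0, with
   a complex [D]: in degree [k] it is [A0 (x) D_k + A1 (x) D_(k-1)], and
   [d (a (x) b) = da (x) b + (-1)^deg a (a (x) db)]. *)
Section TwoTerm.
Variables (A0 A1 : lmodType R) (f : {linear A1 -> A0}) (D : chain R).

Definition two_tens_obj k : lmodType R :=
  match k with
  | 0 => tens A0 (D 0)
  | j.+1 => (tens A0 (D j.+1) * tens A1 (D j))%type
  end.

Definition two_tens_low k (p : tens A0 (D k.+1) * tens A1 (D k)) : tens A0 (D k) :=
  tens_map (idfun : {linear A0 -> A0}) (cdif D k) p.1 +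
  tens_map f (idfun : {linear D k -> D k}) p.2.

Definition two_tens_fun k : two_tens_obj k.+1 -> two_tens_obj k :=
  match k with
  | 0 => @two_tens_low 0
  | j.+1 => fun p => (two_tens_low p,
      - tens_map (idfun : {linear A1 -> A1}) (cdif D j) p.2)
  end.

Fact two_tens_low_linear k : linear (@two_tens_low k).
Proof.
move=> a p q; rewrite /two_tens_low.
have -> : (a *: p + q).1 = a *: p.1 + q.1 by [].
have -> : (a *: p + q).2 = a *: p.2 + q.2 by [].
by rewrite !linearP scalerDr addrACA.
Qed.

Fact two_tens_linear k : linear (@two_tens_fun k).
Proof.
case: k => [|k] a p q; first exact: two_tens_low_linear.
congr pair; first exact: two_tens_low_linear.
have -> : (a *: p + q).2 = a *: p.2 + q.2 by [].
by rewrite linearP opprD -scalerN.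
Qed.

Definition two_tens_dif k : {linear two_tens_obj k.+1 -> two_tens_obj k} :=
  mklin (@two_tens_linear k).

Fact two_tens_difK k x : two_tens_dif k (two_tens_dif k.+1 x) = 0.
Proof.
have low0 j (p : two_tens_obj j.+2) : two_tens_low (two_tens_fun p) = 0.
  rewrite -[LHS]/(tens_map idfun (cdif D j) (tens_map idfun (cdif D j.+1) p.1 +
    tens_map f idfun p.2) + tens_map f idfun (- tens_map idfun (cdif D j) p.2)).
  rewrite linearD linearN !tens_map_comp -addrA.
  rewrite (@eq_tens_map _ _ _ _ _ (idfun \o f) (f \o idfun) (cdif D j \o idfun)
    (idfun \o cdif D j))// subrr addr0 tens_map0r// => y; exact: cdifK.
case: k x => [|k] x; first exact: low0.
congr pair; first exact: low0.
rewrite -[LHS]/(- tens_map idfun (cdif D k)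
  (- tens_map idfun (cdif D k.+1) x.2)).
rewrite linearN opprK tens_map_comp tens_map0r// => y; exact: cdifK.
Qed.

Definition two_tens : chain R := Chain two_tens_difK.
End TwoTerm.

Definition unit_obj k : lmodType R := if k is 0 then R^o else 'rV[R]_0.

Definition unit_chain : chain R :=
  @Chain R unit_obj (fun k => \0) (fun k x => erefl).

Fixpoint koszul (x : seq R) : chain R :=
  if x is a :: x' then two_tens (scale_by R^o a) (koszul x') else unit_chain.

(* [F_(k-1)^* -> F_k^*], for [k] positive. *)
Definition koszul_coker (x : seq R) k : lmodType R :=
  coker (dual_map (cdif (koszul x) k.-1)).

Definition ideal_gen (x : seq R) : {pred R^o} := span_pred [set` (x : seq R^o)].

End Koszul.

(* Main.v *)
Require Import Defs.
From HB Require Import structures.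
From mathcomp Require Import all_boot all_order all_algebra.
From mathcomp Require Import ring_quotient.
From mathcomp Require Import finmap.
From mathcomp Require Import all_classical.

Set Implicit Arguments.
Unset Strict Implicit.
Unset Printing Implicit Defensive.

Import GRing.Theory.
Local Open Scope ring_scope.

Local Notation surj := Defs.surj.
Local Notation hom := Defs.hom.

(** Write x_1, ..., x_m for the generators of I, and let K be the class of the
    modules M with Ext^i (R/I, M) = 0 for i < n.

    Everything rests on two functors attached to the cover of the complement of
    the zero set of I by the open sets where some x_i is invertible:
    - L M, the product of the localizations of M at the x_i ([locm]);
    - D V, the product over i of the modules Hom (R[1/x_i], V) ([towers]),
      presented as the towers (w_k) with w_k = x_i w_(k+1).
    They are adjoint, Hom (L M, V) = Hom (M, D V), and both take values in
    modules on which the identity is a combination of the x_i.  Such a module is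
    acyclic for every complex of projectives on which each x_i is homotopic to
    zero ([saturated_Hom_exact]); this applies to projective resolutions of R/I
    and to the Koszul complex.  If nothing nonzero in M is killed by I, then M
    embeds in L M, and passing to the cokernel lowers by one the degree of every
    obstruction.  So M lies in K iff M and its first n - 1 iterated cokernels of
    this kind have no nonzero element killed by I ([depth_ge]), and this in turn
    says that the Koszul cohomology of M vanishes below degree n
    ([depth_Hom_exact], [Ext_quotient_depth], [koszul_depth]).

    (i), (ii).  Applied to M = R, this shows that the dual Koszul complex, cut
    off in degree n, is a finite resolution of the cokernel S by finitely
    generated projectives ([flip_resolution]).  Dual bases identify the complex
    F^* (x) M with Hom (F, M) ([theta]), so Tor_i (S, M) is the Koszul
    cohomology of M in degree n - i, and (ii) follows.  A shorter resolution of
    S would make Tor_n (S, R/I) vanish; but this module consists of the elements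
    of R/I that I kills, and 1 is one of them, nonzero if I is proper.

    (iii).  Let W be an injective cogenerator, here the characters of R with
    values in Q/Z.  The counit D V -> V sums the bottom levels of a tower; let
    P V be its kernel.  Since R is in K, the counits are surjective on
    W, P W, ..., P^(n-1) W, which gives an exact sequence
      0 -> P^n W -> D P^(n-1) W -> ... -> D P W -> D W -> W -> 0
    whose middle terms are injective.  The cotilting module is the product of
    all its terms but W ([cotilt]).  By adjunction, lifting a map M -> V to D V
    is the same as extending it along M -> L M, whose obstruction lies in
    Ext^1 (L M / M, V).  Induction on n turns this into: M lies in K iff
    Ext^1 (M, P^k W) = 0 for k <= n ([depth_extends], [Ext_depth]), and dimension
    shifting along the sequence turns the latter into the vanishing of all
    Ext^i (M, P^n W) with i > 0 ([depth_Ext]). *)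

(** * Linear maps, kernels and cokernels *)

Section LinearTools.
Variable R : comPzRingType.
Implicit Types A B C M U V Y : lmodType R.

Lemma linear_factor U V Y (s : {linear U -> Y}) (t : {linear U -> V}) :
  surj s -> (forall u, s u = 0 -> t u = 0) ->
  exists t' : {linear Y -> V}, forall u, t' (s u) = t u.
Proof.
move=> ss st; have [r rE] := choice ss.
have tE u u' : s u = s u' -> t u = t u'.
  move=> suu; apply/subr0_eq; rewrite -linearB; apply: st.
  by rewrite linearB suu subrr.
have rl : linear (t \o r).
  by move=> a y y' /=; rewrite -linearP; apply: tE; rewrite rE linearP !rE.
by exists (mklin rl) => u; apply: tE; rewrite rE.
Qed.

Lemma linear_colift A B U (j : {linear A -> B}) (f : {linear U -> B}) :
  injective j -> (forall u, exists a, j a = f u) ->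
  exists g : {linear U -> A}, forall u, j (g u) = f u.
Proof.
move=> ji jf; have [g gE] := choice jf.
have gl : linear g by move=> a u v; apply: ji; rewrite linearP !gE linearP.
by exists (mklin gl).
Qed.

Fact pair_lin_subproof U A B (f : {linear U -> A}) (g : {linear U -> B}) :
  linear ((fun u => (f u, g u)) : U -> (A * B)%type).
Proof. by move=> r u v; rewrite !linearP. Qed.

Definition pair_lin U A B (f : {linear U -> A}) (g : {linear U -> B}) :
    {linear U -> (A * B)%type} := mklin (pair_lin_subproof f g).

Lemma linear_inj0 A B (j : {linear A -> B}) :
  (forall a, j a = 0 -> a = 0) -> injective j.
Proof.
by move=> j0 a b jab; apply/subr0_eq/j0; rewrite linearB jab subrr.
Qed.

Definition ses A B C (j : {linear A -> B}) (p : {linear B -> C}) :=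
  [/\ injective j, exact_at j p & surj p].

Definition ker_incl U V (f : {linear U -> V}) : {linear ker f -> U} :=
  mklin (@ker_val_linear _ _ _ f).

Lemma ker_incl_inj U V (f : {linear U -> V}) : injective (ker_incl f).
Proof. exact: val_inj. Qed.

Lemma ker_incl_exact U V (f : {linear U -> V}) : exact_at (ker_incl f) f.
Proof.
move=> u; split=> [fu|[v <-]]; last exact: kerP.
have uk : u \in ker_pred f by apply/asboolP.
by exists (Ker uk).
Qed.

Lemma ker_ses U V (f : {linear U -> V}) : surj f -> ses (ker_incl f) f.
Proof. by move=> fs; split=> //; [exact: ker_incl_inj|exact: ker_incl_exact]. Qed.

Definition quot_proj V (S : submodClosed V) : {linear V -> quotmod S} :=
  mklin (@qproj_linear _ _ S).

Lemma quot_projE V (S : submodClosed V) v : quot_proj S v = 0 <-> v \in S.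
Proof.
have -> : 0 = quot_proj S 0 by rewrite linear0.
by rewrite -{2}[v]subr0; exact: qproj_eq.
Qed.

Lemma quot_proj_surj V (S : submodClosed V) : surj (quot_proj S).
Proof. by move=> y; exists (qrepr y); exact: qreprK. Qed.

Definition coker_proj U V (f : {linear U -> V}) : {linear V -> coker f} :=
  quot_proj (im_pred f).

Lemma coker_proj_exact U V (f : {linear U -> V}) : exact_at f (coker_proj f).
Proof.
by move=> v; rewrite /coker_proj quot_projE; split=> /asboolP.
Qed.

Lemma coker_ses U V (f : {linear U -> V}) : injective f -> ses f (coker_proj f).
Proof.
by move=> fi; split=> //; [exact: coker_proj_exact|exact: quot_proj_surj].
Qed.

End LinearTools.

(** * Dimension shifting in complexes of homomorphisms *)

Section Shift.
Variable R : comPzRingType.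
Implicit Types (A B C M N V : lmodType R) (P : chain R).

(** [Hom_exact] matches on the degree; this form can be used while the degree is
    still a variable. *)
Lemma Hom_exactP P N i (f : {linear P i -> N}) : Hom_exact P N i ->
  (forall x, f (cdif P i x) = 0) ->
  match i return {linear P i -> N} -> Prop with
  | 0 => fun f => forall y, f y = 0
  | j.+1 => fun f =>
      exists g : {linear P j -> N}, forall y, f y = g (cdif P j y)
  end f.
Proof. by case: i f => [|i] f; apply. Qed.

(** The connecting map of the long exact sequence is an isomorphism when the
    middle term is acyclic in the two degrees concerned; projectivity of the
    terms of P serves to lift cochains along B -> C. *)
Lemma Hom_exact_shift P A B C (j : {linear A -> B}) (p : {linear B -> C}) i :
  (forall k, projective (P k)) -> ses j p ->
  Hom_exact P B i -> Hom_exact P B i.+1 ->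
  Hom_exact P A i.+1 <-> Hom_exact P C i.
Proof.
move=> Pp [ji jp ps] Bi BSi.
have pj a : p (j a) = 0 by apply/jp; exists a.
split=> [PA|PC].
- have main (c : {linear P i -> C}) : (forall x, c (cdif P i x) = 0) ->
      exists c' a' : {linear P i -> _}, (forall y, p (c' y) = c y) /\
      (forall x, c' (cdif P i x) - j (a' (cdif P i x)) = 0).
    move=> c0; have [c' c'E] := Pp i _ _ p c ps.
    have [a aE] : exists a : {linear P i.+1 -> A},
        forall x, j (a x) = c' (cdif P i x).
      apply: (linear_colift (f := c' \o cdif P i) ji) => x.
      by apply/jp; rewrite /= c'E c0.
    have [|a' a'E] := PA a.
      by move=> x; apply: ji; rewrite aE cdifK !linear0.
    by exists c', a'; split=> // x; rewrite -a'E aE subrr.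
  (* The lift c' of the cocycle c has been corrected by A into a cocycle of B,
     which is a coboundary, or zero in degree 0. *)
  case: i Bi BSi PA main => [|i] Bi BSi PA main c c0.
    move=> y; have [c' [a' [c'E c'a']]] := main c c0.
    have := Bi (c' \- (j \o a')) c'a' y; rewrite /= => /subr0_eq cj.
    by rewrite -c'E cj pj.
  have [c' [a' [c'E c'a']]] := main c c0.
  have [b bE] := Bi (c' \- (j \o a')) c'a'.
  by exists (p \o b) => y; rewrite /= -bE /= linearB c'E pj subr0.
- move=> f f0.
  have [|g gE] := BSi (j \o f); first by move=> x; rewrite /= f0 linear0.
  have pg x : p (g (cdif P i x)) = 0 by rewrite -gE /= pj.
  (* j f is the coboundary of g; changing g by a coboundary makes it land in A. *)
  suff [g' [g'd g'E]] : exists g' : {linear P i -> B},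
      (forall x, g' (cdif P i x) = g (cdif P i x)) /\ forall y, p (g' y) = 0.
    have [|a aE] := linear_colift (f := g') ji; first by move=> y; apply/jp.
    by exists a => y; apply: ji; rewrite aE g'd -gE.
  move: (Hom_exactP (f := p \o g) PC pg).
  case: i {Bi BSi PC} f f0 g gE pg => [|i] f f0 g gE pg; first by exists g.
  move=> [c cE]; have [c' c'E] := Pp i _ _ p c ps.
  exists (g \- (c' \o cdif P i)); split=> [x|y] /=.
    by rewrite cdifK linear0 subr0.
  by rewrite linearB c'E -cE subrr.
Qed.

Lemma Hom_exact_injective P E : injective_mod E ->
  (forall k, exact_at (cdif P k.+1) (cdif P k)) ->
  forall i, Hom_exact P E i.+1.
Proof.
move=> Ei Pe i f f0.
pose im := ker_incl (coker_proj (cdif P i)).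
have [q qE] : exists q : {linear P i.+1 -> ker (coker_proj (cdif P i))},
    forall x, im (q x) = cdif P i x.
  apply: (linear_colift (@ker_incl_inj _ _ _ _)) => x.
  by apply/(ker_incl_exact (coker_proj _))/(coker_proj_exact (cdif P i)); exists x.
have qs : surj q.
  move=> y; have [x xE] : exists x, cdif P i x = im y.
    by apply/(coker_proj_exact (cdif P i)); exact: kerP.
  by exists x; apply: ker_incl_inj; rewrite qE.
have [|f' f'E] := linear_factor (t := f) qs.
  move=> x qx; have /Pe[y <-] : cdif P i x = 0 by rewrite -qE qx linear0.
  exact: f0.
have [g gE] := Ei _ _ im f' (@ker_incl_inj _ _ _ _).
by exists g => y; rewrite -f'E -gE qE.
Qed.

Lemma Hom_exact_prod P A B i :
  Hom_exact P (A * B)%type i <-> Hom_exact P A i /\ Hom_exact P B i.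
Proof.
pose pr1 : {linear (A * B)%type -> A} := (fst : (A * B)%type -> A).
pose pr2 : {linear (A * B)%type -> B} := (snd : (A * B)%type -> B).
pose in1 : {linear A -> (A * B)%type} := pair_lin idfun \0.
pose in2 : {linear B -> (A * B)%type} := pair_lin \0 idfun.
case: i => [|i]; split.
- move=> H; split=> f f0 y.
    have /(congr1 fst)//: (in1 \o f) y = 0.
    by apply: H => x; rewrite -[LHS]/(in1 (f _)) f0 linear0.
  have /(congr1 snd)//: (in2 \o f) y = 0.
  by apply: H => x; rewrite -[LHS]/(in2 (f _)) f0 linear0.
- move=> [HA HB] f f0 y; rewrite [f y]surjective_pairing.
  have -> : (f y).1 = 0 by apply: (HA (pr1 \o f)) => x /=; rewrite f0.
  by have -> : (f y).2 = 0 by apply: (HB (pr2 \o f)) => x /=; rewrite f0.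
- move=> H; split=> f f0.
    have [|g gE] := H (in1 \o f).
      by move=> x; rewrite -[LHS]/(in1 (f _)) f0 linear0.
    by exists (pr1 \o g) => y; rewrite /= -gE.
  have [|g gE] := H (in2 \o f).
    by move=> x; rewrite -[LHS]/(in2 (f _)) f0 linear0.
  by exists (pr2 \o g) => y; rewrite /= -gE.
- move=> [HA HB] f f0.
  have [|g gE] := HA (pr1 \o f); first by move=> x /=; rewrite f0.
  have [|h hE] := HB (pr2 \o f); first by move=> x /=; rewrite f0.
  exists (pair_lin g h) => y.
  by rewrite [f y]surjective_pairing; congr pair; rewrite -?gE -?hE.
Qed.

Lemma Hom_exact_power P A (X : Type) i :
  Hom_exact P A i -> Hom_exact P (X -> A) i.
Proof.
have evl (t : X) : linear ((fun f => f t) : (X -> A) -> A) by [].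
case: i => [|i] HA f f0.
  move=> y; apply/funext => t.
  by apply: (HA (mklin (evl t) \o f)) => x /=; rewrite f0.
have /choice[g gE] t : exists g : {linear P i -> A},
    forall y, f y t = g (cdif P i y).
  by apply: (HA (mklin (evl t) \o f)) => x /=; rewrite f0.
have gl : linear ((fun y t => g t y) : P i -> (X -> A)).
  by move=> r u v; apply/funext => t; rewrite linearP.
by exists (mklin gl) => y; apply/funext => t; exact: gE.
Qed.

End Shift.

(** * Towers and localizations at the generators *)

Section Localization.
Variables (R : comPzRingType) (x : seq R).
Local Notation I := 'I_(size x).
Implicit Types M N V W Y : lmodType R.

(** The x_i generate the unit ideal of an algebra acting on Y, as for a module
    supported off the zero set of I. *)
Definition saturated Y := exists s : I -> {linear Y -> Y},
  forall y, \sum_(i : I) x`_i *: s i y = y.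

Definition torsion_free M := forall m : M, (forall i : I, x`_i *: m = 0) -> m = 0.

(** The product of the modules Hom (R[1/x_i], V), known only through its
    universal property: a homomorphism out of R[1/x_i] is the sequence of its
    values w_k at x_i^(-k).  The module is chosen by an opaque proof below, so
    that unification never unfolds its construction. *)
Record tower_module V := TowerModule {
  tower_obj : lmodType R;
  tower_level : nat -> I -> {linear tower_obj -> V};
  tower_level_step : forall k i w,
    tower_level k i w = x`_i *: tower_level k.+1 i w;
  tower_level_ext : forall w w',
    (forall k i, tower_level k i w = tower_level k i w') -> w = w';
  tower_lift : forall M (f : nat -> I -> {linear M -> V}),
    (forall k i m, f k i m = x`_i *: f k.+1 i m) ->
    exists h : {linear M -> tower_obj},
      forall m k i, tower_level k i (h m) = f k i m }.

Fact tower_defect_linear V :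
  linear ((fun w k i => w k i - x`_i *: w k.+1 i) : (nat -> I -> V) -> (nat -> I -> V)).
Proof.
move=> a u v; apply/funext => k; apply/funext => i.
have E (s t : nat -> I -> V) l : (a *: s + t) l i = a *: s l i + t l i by [].
by rewrite !E scalerDr opprD addrACA !scalerA mulrC -!scalerA -scalerBr.
Qed.

Fact tower_module_exists V : tower_module V.
Proof.
pose defect := mklin (@tower_defect_linear V).
have lev_lin k i : linear (fun w : ker defect => ker_val w k i) by [].
apply: (@TowerModule V (ker defect) (fun k i => mklin (lev_lin k i))) => /=.
- by move=> k i w; apply/subr0_eq; rewrite -[LHS]/(defect _ k i) kerP.
- move=> w w' ww; apply: val_inj; apply/funext => k; apply/funext => i.
  exact: ww.
move=> M f fE; have hk m : (fun k i => f k i m) \in ker_pred defect.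
  apply/asboolP; apply/funext => k; apply/funext => i.
  by rewrite -[LHS]/(f k i m - x`_i *: f k.+1 i m) -fE subrr.
have hl : linear (fun m => Ker (hk m) : ker defect).
  move=> a u v; apply: val_inj; apply/funext => k; apply/funext => i.
  exact: linearP.
by exists (mklin hl).
Qed.

(** The right adjoint D of the introduction. *)
Definition towers V : lmodType R := tower_obj (tower_module_exists V).

Definition level V k i : {linear towers V -> V} :=
  tower_level (tower_module_exists V) k i.

Lemma levelE V k i (w : towers V) : level V k i w = x`_i *: level V k.+1 i w.
Proof. exact: tower_level_step. Qed.

Lemma levelX V k l i (w : towers V) :
  level V k i w = x`_i ^+ l *: level V (l + k) i w.
Proof.
by elim: l => [|l ->]; rewrite ?scale1r// levelE scalerA -exprSr.
Qed.

Lemma level_ext V (w w' : towers V) :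
  (forall k i, level V k i w = level V k i w') -> w = w'.
Proof. exact: tower_level_ext. Qed.

Lemma towers_lift M V (f : nat -> I -> {linear M -> V}) :
  (forall k i m, f k i m = x`_i *: f k.+1 i m) ->
  exists h : {linear M -> towers V}, forall m k i, level V k i (h m) = f k i m.
Proof. exact: tower_lift. Qed.

Fact counit_exists V :
  {f : {linear towers V -> V} | forall w, f w = \sum_i level V 0 i w}.
Proof.
have l : linear (fun w : towers V => \sum_i level V 0 i w).
  move=> a u v; rewrite scaler_sumr -big_split.
  by apply: eq_bigr => i _; rewrite linearP.
by exists (mklin l).
Qed.

(** Restriction of homomorphisms along R -> R[1/x_1] * ... * R[1/x_m]. *)
Definition counit V : {linear towers V -> V} := sval (counit_exists V).

Lemma counitE V w : counit V w = \sum_i level V 0 i w.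
Proof. exact: (svalP (counit_exists V)). Qed.

Definition tower_syz V : lmodType R := ker (counit V).

(** Shifting the i-th tower by one level divides it by x_i. *)
Lemma towers_saturated V : saturated (towers V).
Proof.
have /choice[s sE] j : exists s : {linear towers V -> towers V}, forall w k i,
    level V k i (s w) = (if i == j then level V k.+1 i else \0) w.
  apply: towers_lift => k i w.
  by case: eqP => _; [exact: levelE|rewrite scaler0].
exists s => w; apply: level_ext => k i.
rewrite linear_sum (bigD1 i)//= big1 ?addr0.
  by rewrite linearZ/= sE eqxx -levelE.
by move=> j ji; rewrite linearZ/= sE eq_sym (negPf ji) scaler0.
Qed.

(** The localization of M at x_i, realized as the sequences s in M with
    s (k + 1) = x_i s k for large k, modulo those that vanish for large k: the
    fraction m / x_i^k is the germ of l |-> x_i^(l - k) m.  In this model it is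
    visible which fractions vanish, and that injections stay injective. *)
Section Germs.
Variable M : lmodType R.
Local Notation fam := (nat -> I -> M).

Definition ev0_pred : {pred fam} :=
  fun s => `[< exists k, forall l, (k <= l)%N -> forall i, s l i = 0 >].

Fact ev0_closed : subsemimod_closed ev0_pred.
Proof.
split; first split.
- by apply/asboolP; exists 0%N.
- move=> s t /asboolP[k sk] /asboolP[l tl]; apply/asboolP; exists (maxn k l).
  move=> r; rewrite geq_max => /andP[kr lr] i.
  by rewrite -[LHS]/(s r i + t r i) sk// tl// addr0.
- move=> a s /asboolP[k sk]; apply/asboolP; exists k => r kr i.
  by rewrite -[LHS]/(a *: s r i) sk// scaler0.
Qed.
HB.instance Definition _ :=
  GRing.isSubmodClosed.Build R fam ev0_pred ev0_closed.

Fact geo_defect_linear :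
  linear ((fun s k i => s k.+1 i - x`_i *: s k i) : fam -> fam).
Proof.
move=> a u v; apply/funext => k; apply/funext => i.
have E (s t : fam) l : (a *: s + t) l i = a *: s l i + t l i by [].
by rewrite !E scalerDr opprD addrACA !scalerA mulrC -!scalerA -scalerBr.
Qed.

Definition ev_geo : lmodType R :=
  ker (quot_proj ev0_pred \o mklin geo_defect_linear).

Definition term (u : ev_geo) k i : M := ker_val u k i.
Arguments term : simpl never.

Lemma ev_geoP (u : ev_geo) : exists k, forall l, (k <= l)%N ->
  forall i, term u l.+1 i = x`_i *: term u l i.
Proof.
have := kerP u; rewrite /= => /quot_projE/asboolP[k H].
by exists k => l kl i; apply/subr0_eq; exact: H.
Qed.

Lemma ev_geo_lift N (f : nat -> I -> {linear N -> M}) :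
  (forall n, exists k, forall l, (k <= l)%N ->
     forall i, f l.+1 i n = x`_i *: f l i n) ->
  exists h : {linear N -> ev_geo}, forall n k i, term (h n) k i = f k i n.
Proof.
move=> fE.
have hk n : (fun k i => f k i n) \in
    ker_pred (quot_proj ev0_pred \o mklin geo_defect_linear).
  apply/asboolP/quot_projE/asboolP; have [k H] := fE n; exists k => l kl i.
  by rewrite -[LHS]/(f l.+1 i n - x`_i *: f l i n) -H// subrr.
have hl : linear (fun n => Ker (hk n)).
  move=> a u v; apply: val_inj; apply/funext => k; apply/funext => i.
  exact: linearP.
by exists (mklin hl).
Qed.

Definition germs : lmodType R :=
  quotmod (ker_pred (quot_proj ev0_pred \o ker_incl _ : {linear ev_geo -> _})).

Definition germ : {linear ev_geo -> germs} := quot_proj _.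

Lemma germ_surj : surj germ.
Proof. exact: quot_proj_surj. Qed.

Lemma germZ a u : germ (a *: u) = a *: germ u.
Proof. exact: linearZ. Qed.

Lemma germ0P u : germ u = 0 <->
  exists k, forall l, (k <= l)%N -> forall i, term u l i = 0.
Proof.
rewrite quot_projE; split; first by move=> /asboolP/quot_projE/asboolP.
by move=> H; apply/asboolP/quot_projE/asboolP.
Qed.

Lemma germP u v : (exists k, forall l, (k <= l)%N -> forall i, term u l i = term v l i) ->
  germ u = germ v.
Proof.
move=> [k H]; apply/subr0_eq; rewrite -linearB; apply/germ0P; exists k => l kl i.
by rewrite -[LHS]/(term u l i - term v l i) H// subrr.
Qed.

Lemma term_sum k i (J : finType) (F : J -> ev_geo) :
  term (\sum_j F j) k i = \sum_j term (F j) k i.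
Proof. by apply: (big_morph (fun w => term w k i)). Qed.

(** The tower of the fractions m / x_i^k; their representatives start at
    level k. *)
Lemma germ_unit : exists eta : {linear M -> towers germs},
  forall m k i, exists u, level germs k i (eta m) = germ u /\
   forall l j, term u l j =
     if (j == i) && (k <= l)%N then x`_i ^+ (l - k) *: m else 0.
Proof.
have /choice[t0 t0E] (p : nat * I) : exists h : {linear M -> ev_geo},
    forall n l j, term (h n) l j =
      (if (j == p.2) && (p.1 <= l)%N then scale_by M (x`_(p.2) ^+ (l - p.1)) else \0) n.
  apply: ev_geo_lift => n; exists p.1 => l kl i.
  rewrite kl (leqW kl) !andbT; case: eqP => [->|]; last by rewrite scaler0.
  by rewrite -[RHS]/(_ *: (_ *: n)) scalerA -exprS subSn.
have [|eta etaE] := towers_lift (f := fun k i => germ \o t0 (k, i)).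
  move=> k i m /=; rewrite -germZ; apply: germP; exists k.+1 => l kl j.
  rewrite -[RHS]/(x`_i *: term (t0 (k.+1, i) m) l j) !t0E/= kl (ltnW kl) !andbT.
  case: eqP => _; last by rewrite scaler0.
  by rewrite -[RHS]/(_ *: (_ *: m)) scalerA -exprS subnSK.
exists eta => m k i; exists (t0 (k, i) m); split; first exact: etaE.
by move=> l j; rewrite t0E/=; case: ifP.
Qed.

End Germs.

(** The product of the localizations of M at the x_i, with the tower
    k, i |-> m / x_i^k of each m: all elements are sums of fractions with a common
    exponent, a sum of fractions vanishes only if the numerators are killed by a
    power of the x_i, and the unit M -> D L M is universal. *)
Record localization M := Localization {
  loc_obj : lmodType R;
  loc_unit : {linear M -> towers loc_obj};
  loc_surj : forall y, exists l (m : I -> M),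
    y = \sum_i level loc_obj l i (loc_unit (m i));
  loc_eq0 : forall l (m : I -> M),
    \sum_i level loc_obj l i (loc_unit (m i)) = 0 ->
    exists k, forall i : I, x`_i ^+ k *: m i = 0;
  loc_univ : forall V (h : {linear M -> towers V}),
    exists g : {linear loc_obj -> V},
      forall m k i, g (level loc_obj k i (loc_unit m)) = level V k i (h m) }.

Fact localization_exists M : localization M.
Proof.
have /cid[eta etaP] := germ_unit M.
have sumE l (m : I -> M) : exists u,
    \sum_i level _ l i (eta (m i)) = germ M u /\
    forall r i, (l <= r)%N -> term u r i = x`_i ^+ (r - l) *: m i.
  have /choice[v /all_and2[vE vT]] i := etaP (m i) l i.
  under eq_bigr => i _ do rewrite vE.
  rewrite -linear_sum; exists (\sum_i v i); split=> // r j lr.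
  rewrite term_sum (bigD1 j)//= big1 ?addr0; first by rewrite vT eqxx lr.
  by move=> i ij; rewrite vT eq_sym (negPf ij).
apply: (@Localization M (germs M) eta).
- move=> y; have [u <-] := germ_surj y; have [k H] := ev_geoP u.
  exists k, (term u k); have [v [-> vE]] := sumE k (term u k).
  apply: germP; exists k => r kr j; rewrite vE//.
  rewrite -{1}(subnK kr); elim: (r - k)%N => [|d IH].
    by rewrite add0n scale1r.
  by rewrite addSn H ?IH ?scalerA ?exprS// leq_addl.
- move=> l m; have [u [-> uE]] := sumE l m => /germ0P[k H]; exists k => i.
  by have := H (k + l)%N (leq_addr _ _) i; rewrite uE ?leq_addl// addnK.
move=> V h.
(* The map on germs is the eventual value of the sums of h (s_l) at level l. *)
pose val (u : ev_geo M) l := \sum_i level V l i (h (term u l i)).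
have valE u : exists c, exists k, forall l, (k <= l)%N -> val u l = c.
  have [k H] := ev_geoP u; exists (val u k), k => l /subnK <-.
  elim: (l - k)%N => [//|d <-]; rewrite addSn; apply: eq_bigr => i _.
  by rewrite H ?leq_addl// !linearZ/= -levelE.
have [g0 g0E] := choice valE.
have g0U u c : (exists k, forall l, (k <= l)%N -> val u l = c) -> g0 u = c.
  move=> [k H]; have [k' H'] := g0E u.
  by rewrite -(H (maxn k k')) ?leq_maxl// H' ?leq_maxr.
have g0l : linear g0.
  move=> a u v; have [k H] := g0E u; have [k' H'] := g0E v.
  apply: g0U; exists (maxn k k') => l; rewrite geq_max => /andP[kl kl'].
  rewrite -(H l)// -(H' l)// /val scaler_sumr -big_split/=; apply: eq_bigr => i _.
  by rewrite -!linearP.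
have [|g gE] := linear_factor (t := mklin g0l) (@germ_surj M).
  move=> u /germ0P[k H]; apply: g0U; exists k => l kl.
  by apply: big1 => i _; rewrite H// !linear0.
exists g => m k i; have [u [-> uE]] := etaP m k i.
rewrite gE; apply: g0U; exists k => l kl; rewrite /val (bigD1 i)//= big1.
  by rewrite uE eqxx kl/= addr0 !linearZ/= (levelX k (l - k)) subnK.
by move=> j ji; rewrite uE (negPf ji) !linear0.
Qed.

Definition locm M : lmodType R := loc_obj (localization_exists M).

Definition unit_map M : {linear M -> towers (locm M)} :=
  loc_unit (localization_exists M).

(** m |-> m / x_i^k. *)
Definition frac M k i : {linear M -> locm M} := level (locm M) k i \o unit_map M.

Definition loc M : {linear M -> locm M} := counit (locm M) \o unit_map M.

Lemma locE M m : loc M m = \sum_i frac M 0 i m.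
Proof. exact: counitE. Qed.

Lemma frac_step M k i m : frac M k i m = x`_i *: frac M k.+1 i m.
Proof. exact: levelE. Qed.

Lemma frac_surj M (y : locm M) : exists l (m : I -> M), y = \sum_i frac M l i (m i).
Proof. exact: loc_surj. Qed.

Lemma frac_eq0 M l (m : I -> M) : \sum_i frac M l i (m i) = 0 ->
  exists k, forall i : I, x`_i ^+ k *: m i = 0.
Proof. exact: loc_eq0. Qed.

Lemma frac_univ M V (f : nat -> I -> {linear M -> V}) :
  (forall k i m, f k i m = x`_i *: f k.+1 i m) ->
  exists g : {linear locm M -> V}, forall m k i, g (frac M k i m) = f k i m.
Proof.
move=> /towers_lift[h hE].
have [g gE] := loc_univ (localization_exists M) h.
by exists g => m k i; rewrite gE.
Qed.

Lemma locm_saturated M : saturated (locm M).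
Proof.
have /choice[s sE] j : exists s : {linear locm M -> locm M}, forall m k i,
    s (frac M k i m) = (if i == j then frac M k.+1 i else \0) m.
  apply: frac_univ => k i m.
  by case: eqP => _; [exact: frac_step|rewrite scaler0].
exists s => y; have [l [m ->]] := frac_surj y.
under eq_bigr => i _ do rewrite linear_sum scaler_sumr.
rewrite exchange_big; apply: eq_bigr => j _ /=.
rewrite (bigD1 j)//= big1 ?addr0; first by rewrite sE eqxx -frac_step.
by move=> i ij; rewrite sE eq_sym (negPf ij) scaler0.
Qed.

(** One half of the adjunction between L and D. *)
Lemma loc_lift M V (g : {linear locm M -> V}) :
  exists h : {linear M -> towers V},
    (forall m k i, level V k i (h m) = g (frac M k i m)) /\
    forall m, counit V (h m) = g (loc M m).
Proof.
have [|h hE] := towers_lift (f := fun k i => g \o frac M k i).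
  by move=> k i m; rewrite /= -linearZ -levelE.
exists h; split=> // m.
by rewrite locE counitE linear_sum; apply: eq_bigr => i _; exact: hE.
Qed.

(** The other half: a lift of f : M -> V to the towers extends f to L M. *)
Lemma loc_extend M V (h : {linear M -> towers V}) :
  exists g : {linear locm M -> V},
    (forall m k i, g (frac M k i m) = level V k i (h m)) /\
    forall m, g (loc M m) = counit V (h m).
Proof.
have [|g gE] := frac_univ (f := fun k i => level V k i \o h).
  by move=> k i m; exact: levelE.
exists g; split=> // m.
by rewrite locE counitE linear_sum; apply: eq_bigr => i _; exact: gE.
Qed.

(** Flatness of localization. *)
Lemma loc_map M N (j : {linear M -> N}) : injective j ->
  exists J : {linear locm M -> locm N}, injective J /\
    forall m k i, J (frac M k i m) = frac N k i (j m).
Proof.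
move=> ji; have [|J JE] := frac_univ (f := fun k i => frac N k i \o j).
  by move=> k i m; exact: frac_step.
exists J; split=> //; apply: linear_inj0 => y.
have [l [m ->]] := frac_surj y; rewrite linear_sum.
under eq_bigr => i _ do rewrite JE.
move=> /frac_eq0[k H]; apply: big1 => i _ /=.
have xm : x`_i ^+ k *: m i = 0 by apply: ji; rewrite linearZ linear0; exact: H.
by rewrite /frac /= (levelX l k) -linearZ -linearZ xm !linear0.
Qed.

(** If some e_i > 0, then x_i m satisfies the hypothesis for a smaller exponent
    vector, hence vanishes by induction; so every x_i kills m.
    If some e_i = 0, then m = 0 by hypothesis. *)
Lemma torsion_free_powers M : torsion_free M -> forall (e : I -> nat) (m : M),
  (forall i : I, x`_i ^+ e i *: m = 0) -> m = 0.
Proof.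
move=> tf e; have [n] := ubnP (\sum_i e i)%N.
elim: n e => // n IH e en m em; apply: tf => i.
have [ei0|ei0] := posnP (e i).
  by have := em i; rewrite ei0 scale1r => ->; rewrite scaler0.
apply: (IH (fun j => e j - (j == i))%N).
  rewrite -ltnS; apply: leq_trans en; rewrite ltnS.
  rewrite [ltnRHS](bigD1 i)//= (bigD1 i)//= eqxx subn1 -addSn prednK// leq_add2l.
  by apply: leq_sum => j _; exact: leq_subr.
move=> j; case: (eqVneq j i) => [->|ji].
  by rewrite subn1 scalerA -exprSr prednK.
by rewrite subn0 scalerA mulrC -scalerA em scaler0.
Qed.

Lemma loc_inj M : torsion_free M -> injective (loc M).
Proof.
move=> tf; apply: linear_inj0 => m; rewrite locE => /frac_eq0[k H].
exact: (torsion_free_powers tf (e := fun=> k)).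
Qed.

End Localization.
Arguments level {R} x V k i.
Arguments frac {R} x M k i.

(** * Depth *)

Section Acyclicity.
Variables (R : comPzRingType) (x : seq R).
Local Notation I := 'I_(size x).
Implicit Types (M N V W Y : lmodType R) (P : chain R).

Definition null_homotopic P (a : R) :=
  exists h : forall k, {linear P k -> P k.+1},
    (forall v, cdif P 0 (h 0 v) = a *: v) /\
    (forall k v, cdif P k.+1 (h k.+1 v) + h k (cdif P k v) = a *: v).

(** If the identity of Y is the sum of the x_i s_i and h_i is a homotopy from x_i
    to zero, then a cocycle f is the coboundary of the sum of the s_i f h_i. *)
Lemma saturated_Hom_exact P Y : (forall i : I, null_homotopic P x`_i) ->
  saturated x Y -> forall j, Hom_exact P Y j.
Proof.
move=> Px [s sE]; have [h /all_and2[h0 hS]] := choice Px.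
case=> [|j] f f0.
  move=> y; rewrite -[LHS]sE big1// => i _.
  by rewrite -!linearZ -h0 f0 linear0.
have gl : linear (fun v => \sum_i s i (f (h i j v))).
  move=> a u v; rewrite scaler_sumr -big_split/=.
  by apply: eq_bigr => i _; rewrite !linearP.
exists (mklin gl) => y; rewrite -[LHS]sE; apply: eq_bigr => i _.
by rewrite -!linearZ -hS linearD f0 add0r.
Qed.

Definition loc_syz M : lmodType R := coker (loc x M).

(** The condition that the grade of I on M is at least n, unwound along the cokernels of M -> L M. *)
Fixpoint depth_ge n M :=
  if n is n'.+1 then torsion_free x M /\ depth_ge n' (loc_syz M) else True.

(** The common reason for which Ext (R/I, -) and Koszul cohomology detect depth:
    L M is acyclic, so M and L M / M have the same obstructions up to a shift. *)
Lemma depth_Hom_exact P : (forall k, projective (P k)) ->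
  (forall i : I, null_homotopic P x`_i) ->
  (forall M, Hom_exact P M 0 <-> torsion_free x M) ->
  forall n M, depth_ge n M <-> forall j, (j < n)%N -> Hom_exact P M j.
Proof.
move=> Pp Px P0; elim=> [|n IH] M; first by split.
have locE j := saturated_Hom_exact Px (locm_saturated x M) j.
have shift j : torsion_free x M ->
    Hom_exact P M j.+1 <-> Hom_exact P (loc_syz M) j.
  by move=> tf; apply: Hom_exact_shift (locE _) (locE _) => //; apply/coker_ses/loc_inj.
split=> [[tf /IH H]|H].
  by case=> [_|j jn]; [apply/P0|apply/shift/H].
have tf : torsion_free x M by apply/P0/H.
by split=> //; apply/IH => j jn; apply/(shift _ tf)/H.
Qed.

End Acyclicity.

(** * Injectivity of the modules of towers *)

Section InjectiveTowers.
Variables (R : comPzRingType) (x : seq R).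
Local Notation I := 'I_(size x).
Implicit Types (M N V W Y : lmodType R) (P : chain R).

(** By adjunction the problem becomes an extension problem from L M to L N with
    values in W. *)
Lemma towers_injective W : injective_mod W -> injective_mod (towers x W).
Proof.
move=> Wi M N j f ji.
have [J [Ji JE]] := loc_map x ji.
have [g [gE _]] := loc_extend f; have [g' g'E] := Wi _ _ J g Ji.
have [h [hE _]] := loc_lift g'; exists h => m; apply: level_ext => k i.
by rewrite hE -JE g'E gE.
Qed.

Lemma towers_map V V' (f : {linear V -> V'}) :
  exists F : {linear towers x V -> towers x V'},
    forall w k i, level x V' k i (F w) = f (level x V k i w).
Proof.
apply: (towers_lift (x := x) (f := fun k i => f \o level x V k i)) => k i w /=.
by rewrite -linearZ -levelE.
Qed.

(** The comultiplication of the comonad D, dual to the product of the algebra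
    R[1/x_1] * ... * R[1/x_m]: its component (i, j) is zero for i <> j and the
    double tower (k, l) |-> w_(k + l) for i = j.  It splits D (D V) -> D V. *)
Lemma comult_exists V : exists s : {linear towers x V -> towers x (towers x V)},
  forall w k i, counit x V (level x _ k i (s w)) = level x V k i w.
Proof.
have /choice[t tE] (p : nat * I) : exists t : {linear towers x V -> towers x V},
    forall w l j, level x V l j (t w) =
      (if j == p.2 then level x V (p.1 + l) j else \0) w.
  apply: towers_lift => l j w; case: eqP => _; last by rewrite scaler0.
  by rewrite addnS; exact: levelE.
have [|s sE] := towers_lift (x := x) (f := fun k i => t (k, i)).
  move=> k i w; apply: level_ext => l j; rewrite linearZ !tE/=.
  case: eqP => [->|_]; last by rewrite scaler0.
  by rewrite addSn; exact: levelE.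
exists s => w k i; rewrite sE counitE (bigD1 i)//= big1 => [|j ji].
  by rewrite tE eqxx addr0 /= addn0.
by rewrite tE (negPf ji).
Qed.

(** Since D is left exact, D (P V) is the kernel of D (D V) -> D V.  This map is
    split, so D (P V) is a direct summand of D (D V), which is injective. *)
Lemma towers_syz_injective V :
  injective_mod (towers x V) -> injective_mod (towers x (tower_syz x V)).
Proof.
move=> DV M N j f ji.
have [inc incE] := towers_map (ker_incl (counit x V)).
have [eps epsE] := towers_map (counit x V).
have [s sE] := comult_exists V.
have [g gE] := towers_injective DV (inc \o f) ji.
(* The projection along the splitting; it does not change maps that already land
   in D (P V). *)
pose g' := g \- (s \o (eps \o g)).
have g'E n k i : level x _ k i (g' n) =
    level x _ k i (g n) - level x _ k i (s (eps (g n))) by rewrite linearB.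
have /choice[q qE] (p : nat * I) : exists q : {linear N -> tower_syz x V},
    forall n, ker_incl _ (q n) = level x _ p.1 p.2 (g' n).
  apply: (linear_colift (f := level x _ p.1 p.2 \o g') (@ker_incl_inj _ _ _ _)).
  move=> n; apply/(ker_incl_exact (counit x V)).
  by rewrite [X in counit x V X]g'E linearB sE epsE subrr.
have [|h hE] := towers_lift (x := x) (f := fun k i => q (k, i)).
  by move=> k i n; apply: ker_incl_inj; rewrite linearZ !qE; exact: levelE.
exists h => m; apply: level_ext => k i; apply: ker_incl_inj.
rewrite hE qE g'E gE -incE.
suff -> : eps (inc (f m)) = 0 by rewrite !linear0 addr0.
apply: level_ext => l i'; rewrite epsE incE linear0.
by apply/(ker_incl_exact (counit x V)); exists (level x _ l i' (f m)).
Qed.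

End InjectiveTowers.

(** * Lifting along the counit and extending along exact sequences *)

Section ExtensionProperty.
Variables (R : comPzRingType) (x : seq R).
Implicit Types (A B C E M N U V W Y : lmodType R) (P : chain R).

(** Ext^1 (M, V) = 0 in a form that mentions no resolution. *)
Definition extends M V := forall A B (j : {linear A -> B}) (p : {linear B -> M}),
  ses j p -> forall f : {linear A -> V}, exists g : {linear B -> V},
  forall a, g (j a) = f a.

Definition lifts M V := forall f : {linear M -> V},
  exists g : {linear M -> towers x V}, forall m, counit x V (g m) = f m.

Lemma injective_extends M E : injective_mod E -> extends M E.
Proof. by move=> Ei A B j p [ji _ _] f; exact: Ei. Qed.

(** Ext^1 (M, P V) is the cokernel of Hom (M, D V) -> Hom (M, V). *)
Lemma lifts_extends M V : injective_mod (towers x V) -> lifts M V ->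
  extends M (tower_syz x V).
Proof.
move=> DV MV A B j p [ji jp ps] f.
have [g gE] := DV _ _ j (ker_incl _ \o f) ji.
have [|v vE] := linear_factor (t := counit x V \o g) ps.
  move=> b /jp[a <-]; apply/(ker_incl_exact (counit x V)).
  by exists (f a); rewrite gE.
have [h hE] := MV v.
have [|k kE] := linear_colift (f := g \- (h \o p)) (@ker_incl_inj _ _ _ (counit x V)).
  move=> b; apply/(ker_incl_exact (counit x V)).
  by rewrite /= linearB hE vE subrr.
exists k => a; apply: ker_incl_inj; rewrite kE -[RHS]gE /=.
by have -> : p (j a) = 0 by [apply/jp; exists a]; rewrite linear0 subr0.
Qed.

(** By adjunction a lift of M -> V to D V is an extension to L M, and the
    obstruction to extending lies in Ext^1 (L M / M, V). *)
Lemma extends_lifts M V : torsion_free x M -> extends (loc_syz x M) V -> lifts M V.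
Proof.
move=> tf XV f; have [g gE] := XV _ _ _ _ (coker_ses (loc_inj tf)) f.
by have [h [_ hE]] := loc_lift g; exists h => m; rewrite hE gE.
Qed.

Lemma resolution_syzygy M P (e : {linear P 0 -> M}) : resolution e ->
  exists q : {linear P 1 -> ker e}, [/\ surj q,
    forall y, ker_incl e (q y) = cdif P 0 y & exact_at (cdif P 1) q].
Proof.
move=> [es e0 eP].
have [|q qE] := linear_colift (f := cdif P 0) (@ker_incl_inj _ _ _ e).
  by move=> y; apply/(ker_incl_exact e)/e0; exists y.
exists q; split=> // [z|y].
  have /e0[y yE] := kerP z; exists y; apply: ker_incl_inj; rewrite qE.
  exact: yE.
rewrite -(eP 0%N y) -qE; split=> [->|]; first by rewrite linear0.
by move=> z0; apply: ker_incl_inj; rewrite z0 linear0.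
Qed.

Lemma extends_Hom_exact M V P (e : {linear P 0 -> M}) : resolution e ->
  extends M V -> Hom_exact P V 1.
Proof.
move=> Pe XV f f0; have [q [qs qE qd]] := resolution_syzygy Pe.
have [|f' f'E] := linear_factor (t := f) qs; first by move=> y /qd[z <-].
have [es _ _] := Pe; have [g gE] := XV _ _ _ _ (ker_ses es) f'.
by exists g => y; rewrite -f'E -gE qE.
Qed.

(** Converse to [lifts_extends]: lift on a projective P_0 that maps onto M, where the
    failure to descend to M is a cocycle with values in P V. *)
Lemma Ext_lifts M V : surj (counit x V) -> Ext_eq0 1 M (tower_syz x V) -> lifts M V.
Proof.
move=> cs MV f; have [P [e [Pe Pp]]] := proj_resolution_exists M.
have [es e0 eP] := Pe.
have [g gE] := Pp 0%N _ _ _ (f \o e) cs.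
have [|a aE] := linear_colift (f := g \o cdif P 0) (@ker_incl_inj _ _ _ (counit x V)).
  move=> y; apply/(ker_incl_exact (counit x V)); rewrite /= gE /=.
  by have -> : e (cdif P 0 y) = 0 by [apply/e0; exists y]; rewrite linear0.
have [|b bE] := MV P e (conj Pe Pp) a.
  by move=> y; apply: ker_incl_inj; rewrite aE /= cdifK !linear0.
have [|h hE] := linear_factor (t := g \- (ker_incl _ \o b)) es.
  by move=> p /e0[y <-]; rewrite -[LHS]/(g _ - ker_incl _ (b _)) -bE aE subrr.
exists h => m; have [p <-] := es m; rewrite hE.
rewrite -[LHS]/(counit x V (g p - ker_incl _ (b p))) linearB gE.
have -> : counit x V (ker_incl _ (b p)) = 0.
  by apply/(ker_incl_exact (counit x V)); exists (b p).
by rewrite subr0.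
Qed.

(** In the exact sequence
      Hom (L M, V) -> Hom (M, V) -> Ext^1 (L M / M, V) -> Ext^1 (L M, V)
    the first map is onto and the last term is zero. *)
Lemma extends_Ext_loc_syz M V : torsion_free x M -> lifts M V ->
  extends (locm x M) V -> Ext_eq0 1 (loc_syz x M) V.
Proof.
move=> tf MV XV P e [Pe Pp] f f0.
have [q [qs qE qd]] := resolution_syzygy Pe.
have [|f' f'E] := linear_factor (t := f) qs; first by move=> y /qd[z <-].
have [li lp ps] := coker_ses (loc_inj tf).
have [es e0 eP] := Pe.
have [c cE] := Pp 0%N _ _ _ e ps.
have [|a aE] := linear_colift (f := c \o ker_incl e) li.
  by move=> z; apply/lp; exact: etrans (cE _) (kerP z).
(* The pullback of P_0 -> L M / M and L M -> L M / M gives the exact sequence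
   0 -> ker e -> P_0 * M -> L M -> 0, along which f' extends.  The restriction of
   the extension to M extends in turn to L M, and subtracting it leaves a map
   that depends on P_0 only. *)
pose S : {linear (P 0 * M)%type -> locm x M} :=
  (c \o (fst : (P 0 * M)%type -> P 0)) \+ (loc x M \o (snd : (P 0 * M)%type -> M)).
have SE b m : S (b, m) = c b + loc x M m by [].
have Sses : ses (pair_lin (ker_incl e) (\- a)) S.
  split.
  - by move=> z z' [zz _]; apply: ker_incl_inj.
  - move=> [b m]; rewrite SE; split=> [cb|[z [<- <-]]]; last first.
      by rewrite linearN aE subrr.
    have /(ker_incl_exact e)[z zE] : e b = 0.
      by rewrite -cE; apply/lp; exists (- m); apply/esym/eqP; rewrite linearN -addr_eq0 cb.
    exists z; congr pair => //; apply: li.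
    rewrite linearN aE -[X in - X]/(c (ker_incl e z)) zE.
    by apply/eqP; rewrite eq_sym -addr_eq0 addrC cb.
  - move=> y; have [b bE] := es (coker_proj (loc x M) y).
    have /lp[m mE] : coker_proj (loc x M) (y - c b) = 0.
      by rewrite linearB cE bE subrr.
    by exists (b, m); rewrite SE mE addrC subrK.
have [G GE] := XV _ _ _ _ Sses f'.
pose in1 : {linear P 0 -> (P 0 * M)%type} := pair_lin idfun \0.
pose in2 : {linear M -> (P 0 * M)%type} := pair_lin \0 idfun.
have [h hE] := MV (G \o in2); have [g [_ gE]] := loc_extend h.
exists ((G \o in1) \- (g \o c)) => y.
rewrite -[RHS]/(G (in1 (cdif P 0 y)) - g (c (cdif P 0 y))) -qE.
have -> : c (ker_incl e (q y)) = loc x M (a (q y)) by rewrite aE.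
rewrite gE hE -f'E -GE -[X in _ - X]/(G (in2 (a (q y)))) -linearB.
by congr (G _); congr pair; rewrite /= ?subr0 ?sub0r.
Qed.

End ExtensionProperty.

(** * The cotilting module *)

Section CotiltingModule.
Variables (R : comPzRingType) (x : seq R).
Implicit Types (A B C E M N U V W Y : lmodType R) (P : chain R).

(** The terms of the sequence of [cotilt_resolution] other than V, multiplied
    together. *)
Fixpoint cotilt n V : lmodType R :=
  if n is n'.+1 then (towers x V * cotilt n' (tower_syz x V))%type else V.

Lemma cotilt_Hom_exact P i n V :
  (forall k, (k < n)%N -> Hom_exact P (towers x (iter k (tower_syz x) V)) i) ->
  Hom_exact P (cotilt n V) i <-> Hom_exact P (iter n (tower_syz x) V) i.
Proof.
elim: n V => [|n IH] V H //.
rewrite [cotilt _ _]/= Hom_exact_prod IH.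
  rewrite iterSr; split=> [[]//|PV]; split=> //; exact: (H 0%N).
by move=> k kn; rewrite -iterSr; exact: H.
Qed.

Definition zero_mod : lmodType R := 'rV[R]_0.

Lemma zero_modP : is_zero zero_mod.
Proof. by move=> v; exact: thinmx0. Qed.

Lemma is_zero_injective E : is_zero E -> injective_mod E.
Proof. by move=> E0 M N g f _; exists \0 => m; rewrite [RHS]E0. Qed.

Lemma injective_prod A B :
  injective_mod A -> injective_mod B -> injective_mod (A * B)%type.
Proof.
move=> Ai Bi M N g f gi.
have [h hE] := Ai _ _ g ((fst : (A * B)%type -> A) \o f) gi.
have [k kE] := Bi _ _ g ((snd : (A * B)%type -> B) \o f) gi.
by exists (pair_lin h k) => m; rewrite /= hE kE -surjective_pairing.
Qed.

Lemma injdim_injective E : injective_mod E -> injdim_le E 0.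
Proof.
move=> Ei.
pose obj k : lmodType R := if k is 0 then E else zero_mod.
pose C : cochain R := @Cochain R obj (fun k => \0) (fun k x => erefl).
exists C, (idfun : {linear E -> E}); split.
  split=> // [v|k v|[|k]//]; first by split=> // _; exists v.
    by split=> // _; exists 0; rewrite linear0; apply/esym/zero_modP.
  exact/is_zero_injective/zero_modP.
by case=> // k _; exact: zero_modP.
Qed.

(** The factor E is added to the degree 0 term of an injective resolution of U. *)
Lemma injdim_prod E U d :
  injective_mod E -> injdim_le U d -> injdim_le (E * U)%type d.
Proof.
move=> Ei [C [e [[ei e0 eC Ci] C0]]].
pose obj k : lmodType R := if k is 0 then (E * C 0)%type else C k.
pose pr2 : {linear (E * C 0)%type -> C 0} := (snd : (E * C 0)%type -> C 0).
pose dif k : {linear obj k -> obj k.+1} :=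
  match k with 0 => ccdif C 0 \o pr2 | k'.+1 => ccdif C k'.+1 end.
have difK k v : dif k.+1 (dif k v) = 0 by case: k v => [|k] v; exact: ccdifK.
exists (@Cochain R obj dif difK), (pair_lin (fst : (E * U)%type -> E)
   (e \o (snd : (E * U)%type -> U))); split.
  split.
  - by move=> [a u] [b v] /= [<- /ei <-].
  - move=> [a c]; rewrite -[X in X <-> _]/(ccdif C 0 c = 0) e0; split.
      by move=> [u <-]; exists (a, u).
    by move=> [[b u] [_ <-]]; exists u.
  - case=> [|k] v; last exact: eC.
    rewrite (eC 0%N v); split=> [[c <-]|[[a c] <-]]; last by exists c.
    by exists (0, c).
  - by case=> [|k]; [exact: injective_prod|exact: Ci].
by case=> [//|k] kd; exact: C0.
Qed.

(** An injective resolution of V is prolonged by D V on the left. *)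
Lemma injdim_syz V d : injective_mod (towers x V) -> surj (counit x V) ->
  injdim_le V d -> injdim_le (tower_syz x V) d.+1.
Proof.
move=> DV cs [C [e [[ei e0 eC Ci] C0]]].
pose obj k : lmodType R := if k is k'.+1 then C k' else towers x V.
pose dif k : {linear obj k -> obj k.+1} :=
  match k with 0 => e \o counit x V | k'.+1 => ccdif C k' end.
have difK k v : dif k.+1 (dif k v) = 0.
  case: k v => [|k] v; last exact: ccdifK.
  by apply/e0; exists (counit x V v).
exists (@Cochain R obj dif difK), (ker_incl (counit x V)); split.
  split.
  - exact: ker_incl_inj.
  - move=> w; rewrite -(ker_incl_exact (counit x V)) /=; split=> [ew|->].
      by apply: ei; rewrite ew linear0.
    exact: linear0.
  - case=> [|k] v; last exact: eC.
    rewrite [X in X <-> _](e0 v); split=> [[u <-]|[w <-]].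
      by have [w <-] := cs u; exists w.
    by exists (counit x V w).
  - by case=> [|k]; [|exact: Ci].
by case=> [//|k] kd; exact: C0.
Qed.

Lemma cotilt_injdim n V d : injective_mod (towers x V) ->
  (forall k, (k < n)%N -> surj (counit x (iter k (tower_syz x) V))) ->
  injdim_le V d -> injdim_le (cotilt n V) (n + d).
Proof.
elim: n V d => [//|n IH] V d DV cs Vd.
apply: injdim_prod => //; rewrite addSnnS; apply: IH.
- exact: towers_syz_injective.
- by move=> k kn; rewrite -iterSr; exact: cs.
- by apply: injdim_syz => //; exact: (cs 0%N).
Qed.

Lemma summand_refl C : summand_of_power C C.
Proof.
have il : linear ((fun c _ => c) : C -> unit -> C) by [].
have pl : linear ((fun f => f tt) : (unit -> C) -> C) by [].
by exists unit, (mklin il), (mklin pl).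
Qed.

Lemma summand_prodl A B : summand_of_power (A * B)%type A.
Proof.
have il : linear ((fun a _ => (a, 0)) : A -> unit -> (A * B)%type).
  by move=> r u v; apply/funext => t; exact: (linearP (pair_lin idfun \0)).
have pl : linear ((fun f => (f tt).1) : (unit -> (A * B)%type) -> A) by [].
by exists unit, (mklin il), (mklin pl).
Qed.

Lemma summand_prodr A B M : summand_of_power B M -> summand_of_power (A * B)%type M.
Proof.
move=> [X [i [p ip]]].
have il : linear ((fun m t => (0, i m t)) : M -> X -> (A * B)%type).
  move=> r u v; apply/funext => t; rewrite linearP.
  exact: (linearP (pair_lin \0 idfun)).
have pl : linear ((fun f => p (fun t => (f t).2)) : (X -> (A * B)%type) -> M).
  by move=> r u v; rewrite -linearP.
by exists X, (mklin il), (mklin pl) => m /=; rewrite -[RHS]ip.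
Qed.

(** The sequence 0 -> P^n V -> D P^(n-1) V -> ... -> D V -> V -> 0, built by
    splicing one short exact sequence at a time. *)
Lemma cotilt_resolution n V :
  (forall k, (k < n)%N -> surj (counit x (iter k (tower_syz x) V))) ->
  exists (P : chain R) (e : {linear P 0 -> V}), [/\ resolution e,
    forall k, (k <= n)%N -> summand_of_power (cotilt n V) (P k) &
    forall k, (n < k)%N -> is_zero (P k)].
Proof.
elim: n V => [|n IH] V cs.
  pose obj k : lmodType R := if k is 0 then V else zero_mod.
  pose P : chain R := @Chain R obj (fun k => \0) (fun k x => erefl).
  exists P, (idfun : {linear V -> V}); split.
  - split=> [v|v|k v]; first by exists v.
      by split=> [v0|[u <-]//]; exists 0; exact: esym v0.
    by split=> // _; exists 0; rewrite linear0; apply/esym/zero_modP.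
  - by case=> // _; exact: summand_refl.
  - by case=> // k _; exact: zero_modP.
have [|P [e [[es e0 eP] Ps P0]]] := IH (tower_syz x V).
  by move=> k kn; rewrite -iterSr; exact: cs.
pose obj k : lmodType R := if k is k'.+1 then P k' else towers x V.
pose dif k : {linear obj k.+1 -> obj k} :=
  match k with 0 => ker_incl (counit x V) \o e | k'.+1 => cdif P k' end.
have difK k v : dif k (dif k.+1 v) = 0.
  case: k v => [|k] v; last exact: cdifK.
  rewrite -[LHS]/(ker_incl (counit x V) (e (cdif P 0 v))).
  have -> : e (cdif P 0 v) = 0 by apply/e0; exists v.
  exact: linear0.
exists (@Chain R obj dif difK), (counit x V); split.
- split=> [|w|k v]; first exact: (cs 0%N).
    rewrite (ker_incl_exact (counit x V)); split=> [[u <-]|[p <-]].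
      by have [p <-] := es u; exists p.
    by exists (e p).
  case: k v => [|k] v; last exact: eP.
  rewrite -[X in _ <-> X]/(exists u, cdif P 0 u = v) -(e0 v).
  rewrite -[X in X <-> _]/(ker_incl (counit x V) (e v) = 0); split=> [ev|->].
    by apply: (@ker_incl_inj _ _ _ (counit x V)); rewrite linear0.
  exact: linear0.
- case=> [_|k kn]; first exact: summand_prodl.
  by apply: summand_prodr; exact: Ps.
- by case=> // k kn; exact: P0.
Qed.

End CotiltingModule.

(** * The cotilting class *)

Section CotiltingClass.
Variables (R : comPzRingType) (x : seq R) (W : lmodType R).
Hypotheses (Wi : injective_mod W) (Wc : cogenerator W).
(* T stands for any complex of projectives that computes depth, such as the
   Koszul complex. *)
Variable T : chain R.
Hypotheses (Tp : forall k, projective (T k))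
  (Tx : forall i : 'I_(size x), null_homotopic T x`_i)
  (T0 : forall M, Hom_exact T M 0 <-> torsion_free x M).
Implicit Types (A B M N V Y : lmodType R) (P : chain R).
Local Notation V_ k := (iter k (tower_syz x) W).

Lemma iter_syz_injective k : injective_mod (towers x (V_ k)).
Proof.
by elim: k => [|k IH]; [exact: towers_injective|exact: towers_syz_injective].
Qed.

(** Induction on n: extending along M for P^(k+1) W needs lifts of M -> P^k W to
    D P^k W, and these exist because L M / M has depth at least n - 1. *)
Lemma depth_extends n M k : depth_ge x n M -> (k <= n)%N -> extends M (V_ k).
Proof.
elim: n M k => [|n IH] M [|k] //; do ?by move=> *; exact: injective_extends.
move=> [tf Mn] kn; apply: lifts_extends; first exact: iter_syz_injective.
by apply: extends_lifts => //; exact: IH.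
Qed.

Lemma depth_lifts n M k : depth_ge x n M -> (k < n)%N -> lifts x M (V_ k).
Proof.
case: n => // n [tf Mn] kn; apply: extends_lifts => //.
exact: depth_extends Mn kn.
Qed.

Lemma saturated_depth n Y : saturated x Y -> depth_ge x n Y.
Proof.
by move=> Ys; apply/(depth_Hom_exact Tp Tx T0) => j _; exact: saturated_Hom_exact.
Qed.

(** Lift the homomorphism R -> P^k W that sends 1 to the given element. *)
Lemma counit_surj n k : depth_ge x n R^o -> (k < n)%N -> surj (counit x (V_ k)).
Proof.
move=> Rn kn v.
have fl : linear ((fun r => r *: v) : R^o -> V_ k).
  by move=> a r s; rewrite scalerDl -scalerA.
have [g gE] := depth_lifts Rn kn (mklin fl).
by exists (g 1); rewrite gE /= scale1r.
Qed.

(** Converse to [depth_extends].  All maps M -> P^k W lift to D P^k W for k < n.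
    For k = 0 this forces I to kill no nonzero element of M, because W is a
    cogenerator and homomorphisms that lift to D W vanish on what all x_i kill;
    then the hypothesis passes to L M / M with n lowered by one. *)
Lemma Ext_depth n M :
  (forall k, (k < n)%N -> surj (counit x (V_ k))) ->
  (forall k, (k <= n)%N -> Ext_eq0 1 M (V_ k)) -> depth_ge x n M.
Proof.
elim: n M => // n IH M cs MV.
have Ml k : (k <= n)%N -> lifts x M (V_ k).
  by move=> kn; apply: Ext_lifts; [exact: cs|exact: (MV k.+1)].
have tf : torsion_free x M.
  move=> m xm; apply: contrapT => m0.
  have fl : linear ((fun r => r *: m) : R^o -> M).
    by move=> a r s; rewrite scalerDl -scalerA.
  have [|h [r]] := Wc (f := mklin fl); first by exists 1; rewrite /= scale1r.
  apply; have [g gE] := Ml 0%N isT h.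
  rewrite -[LHS]/(h (r *: m)) linearZ -gE counitE big1; first exact: scaler0.
  by move=> i _; rewrite levelE -linearZ -linearZ xm !linear0.
split=> //; apply: IH => [k kn|k kn]; first by apply: cs; rewrite ltnW.
apply: extends_Ext_loc_syz => //; first exact: Ml.
exact: depth_extends (saturated_depth n (locm_saturated x M)) kn.
Qed.

(** The modules D P^k W are injective, so Ext^(i+1) (M, P^(k+1) W) is
    Ext^i (M, P^k W) for i > 0. *)
Lemma depth_Ext n : (forall k, (k < n)%N -> surj (counit x (V_ k))) ->
  forall M, depth_ge x n M <-> forall i, (0 < i)%N -> Ext_eq0 i M (V_ n).
Proof.
move=> cs M.
have shift P k i : (forall k, projective (P k)) ->
    (forall k, exact_at (cdif P k.+1) (cdif P k)) -> (k < n)%N ->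
    Hom_exact P (V_ k.+1) i.+2 <-> Hom_exact P (V_ k) i.+1.
  move=> Pp eP kn; have DV := Hom_exact_injective (@iter_syz_injective k) eP.
  exact: Hom_exact_shift (ker_ses (cs _ kn)) (DV i) (DV i.+1).
split=> [Mn [//|i] _ P e [Pe Pp]|MV].
  have [es e0 eP] := Pe.
  suff H k j : (k <= n)%N -> Hom_exact P (V_ k) j.+1 by exact: H.
  elim: k j => [|k IH] [|j] kn.
  - exact: Hom_exact_injective.
  - exact: Hom_exact_injective.
  - exact: extends_Hom_exact Pe (depth_extends Mn kn).
  - by apply/shift => //; apply: IH; exact: ltnW.
apply: Ext_depth => // k kn P e [Pe Pp]; have [es e0 eP] := Pe.
suff H d j l : (l + d = n)%N -> Hom_exact P (V_ l) j.+1.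
  by apply: (H (n - k)%N); rewrite subnKC.
elim: d l j => [|d IH] l j ldn.
  by rewrite addn0 in ldn; rewrite ldn; exact: MV (conj Pe Pp).
apply/shift => //; first by rewrite -ldn addnS ltnS leq_addr.
by apply: IH; rewrite addSnnS.
Qed.

Lemma cotilt_class n : (forall k, (k < n)%N -> surj (counit x (V_ k))) ->
  forall M, depth_ge x n M <-> forall i, (0 < i)%N -> Ext_eq0 i M (cotilt x n W).
Proof.
move=> cs M; rewrite (depth_Ext cs).
have E i P (e : {linear P 0 -> M}) : (0 < i)%N -> proj_resolution e ->
    Hom_exact P (cotilt x n W) i <-> Hom_exact P (V_ n) i.
  case: i => // i _ [[_ _ eP] _]; apply: cotilt_Hom_exact => k _.
  exact: Hom_exact_injective (@iter_syz_injective k) eP _.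
by split=> H i i0 P e Pe; apply/(E _ _ e i0 Pe); apply: H Pe.
Qed.

(** The modules D P^k W are acyclic, so the complex Hom (T, P^(k+1) W) gains one
    degree of exactness over Hom (T, P^k W). *)
Lemma cotilt_depth n : (forall k, (k < n)%N -> surj (counit x (V_ k))) ->
  forall j, (j < n)%N -> Hom_exact T (cotilt x n W) j.
Proof.
move=> cs j jn.
have DT V i : Hom_exact T (towers x V) i.
  exact: saturated_Hom_exact Tx (towers_saturated x V) i.
apply/cotilt_Hom_exact => [k _|]; first exact: DT.
suff H k : (k <= n)%N -> forall j, (j < k)%N -> Hom_exact T (V_ k) j by exact: (H n).
elim: k {j jn} => // k IH kn [|j] jk.
  move=> f f0 y; apply: ker_incl_inj; rewrite linear0.
  apply: (DT (V_ k) 0%N (ker_incl _ \o f)) => z /=.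
  by rewrite f0.
apply/(Hom_exact_shift Tp (ker_ses (cs _ kn)) (DT _ _) (DT _ _)).
by apply: IH => //; exact: ltnW.
Qed.

Theorem cotilt_cotilting n : depth_ge x n R^o -> cotilting n (cotilt x n W).
Proof.
move=> Rn; have cs k kn := counit_surj (k := k) Rn kn.
split.
- by rewrite -[n in injdim_le _ n]addn0; apply: cotilt_injdim => //;
    [exact: towers_injective|exact: injdim_injective].
- move=> X; apply/(cotilt_class cs)/(depth_Hom_exact Tp Tx T0) => j jn.
  exact/Hom_exact_power/cotilt_depth.
- have [P [e [Pe Ps P0]]] := cotilt_resolution cs.
  by exists W, P, e; split.
Qed.

End CotiltingClass.

(** * Comparison of projective resolutions *)

Section Comparison.
Variable R : comPzRingType.
Implicit Types (A B C M N Q U V : lmodType R) (P : chain R).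

Lemma projective_lift Q U V (f : {linear U -> V}) (t : {linear Q -> V}) :
  projective Q -> (forall q, exists u, f u = t q) ->
  exists s : {linear Q -> U}, forall q, f (s q) = t q.
Proof.
move=> Qp tf; pose im := ker_incl (coker_proj f).
have imE v : (exists w, im w = v) <-> exists u, f u = v.
  by rewrite -(ker_incl_exact (coker_proj f)) -(coker_proj_exact f).
have imi : injective im by exact: ker_incl_inj.
have [|f' f'E] := linear_colift (f := f) imi; first by move=> u; apply/imE; exists u.
have [|t' t'E] := linear_colift (f := t) imi; first by move=> q; apply/imE.
have [|s sE] := Qp _ _ f' t'.
  move=> w; have /imE[u uE] : exists w', im w' = im w by exists w.
  by exists u; apply: imi; rewrite f'E.
by exists s => q; rewrite -f'E sE t'E.
Qed.

Definition chain_map P P' (phi : forall k, {linear P k -> P' k}) :=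
  forall k v, cdif P' k (phi k.+1 v) = phi k (cdif P k v).

(** The components are chosen one after the other; the invariant [good] is what
    allows the next lift. *)
Lemma comparison P P' M (e : {linear P 0 -> M}) (e' : {linear P' 0 -> M}) :
  proj_resolution e -> resolution e' ->
  exists phi : forall k, {linear P k -> P' k},
    chain_map phi /\ forall v, e' (phi 0 v) = e v.
Proof.
move=> [[_ e0 eP] Pp] [e's e'0 e'P].
have [f0 f0E] := Pp 0%N _ _ e' e e's.
pose good k (f : {linear P k -> P' k}) :=
  forall v, exists u, cdif P' k u = f (cdif P k v).
have good0 : good 0%N f0.
  by move=> v; apply/e'0; rewrite f0E; apply/e0; exists v.
have step k (f : {linear P k -> P' k}) : good k f ->
    {f' : {linear P k.+1 -> P' k.+1} | good k.+1 f' /\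
       forall v, cdif P' k (f' v) = f (cdif P k v)}.
  move=> fg; apply/cid; have [f' f'E] := projective_lift (t := f \o cdif P k) (Pp _) fg.
  exists f'; split=> // v; apply/e'P; rewrite f'E /=.
  by rewrite cdifK linear0.
pose F := fix F k : {f | good k f} := match k with
  | 0 => exist _ f0 good0
  | j.+1 => let s := step j (sval (F j)) (svalP (F j)) in
            exist _ (sval s) (svalP s).1
  end.
exists (fun k => sval (F k)); split=> // k v.
exact: (svalP (step k (sval (F k)) (svalP (F k)))).2.
Qed.

Lemma null_chain_map P P' M (e' : {linear P' 0 -> M})
    (phi : forall k, {linear P k -> P' k}) :
  (forall k, projective (P k)) -> resolution e' -> chain_map phi ->
  (forall v, e' (phi 0 v) = 0) ->
  exists h : forall k, {linear P k -> P' k.+1},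
    (forall v, cdif P' 0 (h 0 v) = phi 0 v) /\
    forall k v, cdif P' k.+1 (h k.+1 v) + h k (cdif P k v) = phi k.+1 v.
Proof.
move=> Pp [_ e'0 e'P] phid e'phi.
have [|h0 h0E] := projective_lift (f := cdif P' 0) (t := phi 0) (Pp 0%N).
  by move=> v; apply/e'0.
pose good k (h : {linear P k -> P' k.+1}) :=
  forall v, exists u, cdif P' k.+1 u = phi k.+1 v - h (cdif P k v).
have good0 : good 0%N h0.
  by move=> v; apply/e'P; rewrite linearB h0E phid subrr.
have step k (h : {linear P k -> P' k.+1}) : good k h ->
    {h' : {linear P k.+1 -> P' k.+2} | good k.+1 h' /\
       forall v, cdif P' k.+1 (h' v) = phi k.+1 v - h (cdif P k v)}.
  move=> hg; apply/cid.
  have [h' h'E] := projective_lift (t := phi k.+1 \- (h \o cdif P k)) (Pp _) hg.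
  exists h'; split=> // v; apply/e'P.
  by rewrite linearB h'E /= cdifK linear0 subr0 phid subrr.
pose F := fix F k : {h | good k h} := match k with
  | 0 => exist _ h0 good0
  | j.+1 => let s := step j (sval (F j)) (svalP (F j)) in
            exist _ (sval s) (svalP s).1
  end.
exists (fun k => sval (F k)); split=> // k v.
have /(_ v) := (svalP (step k (sval (F k)) (svalP (F k)))).2.
by rewrite -[sval (step _ _ _)]/(sval (F k.+1)) => ->; rewrite subrK.
Qed.

(** Multiplication by a lifts the zero map of M. *)
Lemma resolution_null_homotopic P M (e : {linear P 0 -> M}) (a : R) :
  proj_resolution e -> (forall m : M, a *: m = 0) -> null_homotopic P a.
Proof.
move=> [Pe Pp] aM.
have [||h hE] := null_chain_map (phi := fun k => scale_by (P k) a) Pp Pe.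
- by move=> k v; rewrite /= linearZ.
- by move=> v; rewrite /= linearZ; exact: aM.
by exists h.
Qed.

Local Notation tl f := (tens_map f idfun).

Lemma tens_mapDl A B N (f g : {linear A -> B}) z :
  tens_map (f \+ g) (idfun : {linear N -> N}) z = tl f z + tl g z.
Proof.
apply: (@tens_ext _ _ _ _ _ (tl f \+ tl g)) => a n.
rewrite tens_mapE -[RHS]/(tl f (pure a n) + tl g (pure a n)) !tens_mapE.
exact: (linearD (mklin (pure_linear_l n))).
Qed.

Lemma tens_map_add A B N (f g k : {linear A -> B}) z :
  (forall a, k a = f a + g a) ->
  tens_map k (idfun : {linear N -> N}) z = tl f z + tl g z.
Proof. by move=> kE; rewrite -tens_mapDl; exact: eq_tens_map. Qed.

Lemma tens_map_id A N z :
  tens_map (idfun : {linear A -> A}) (idfun : {linear N -> N}) z = z.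
Proof. by apply: (@tens_ext _ _ _ _ _ idfun) => a n; rewrite tens_mapE. Qed.

Lemma tens_map_compl A B C N (f : {linear A -> B}) (g : {linear B -> C}) z :
  tens_map g (idfun : {linear N -> N}) (tl f z) = tl (g \o f) z.
Proof. by rewrite tens_map_comp; exact: eq_tens_map. Qed.

Lemma tens_map0l A B N (f : {linear A -> B}) z : (forall a, f a = 0) ->
  tens_map f (idfun : {linear N -> N}) z = 0.
Proof.
move=> f0; apply: (@tens_ext _ _ _ _ _ \0) => a n; rewrite tens_mapE f0.
exact: (linear0 (mklin (pure_linear_l n))).
Qed.

(** The composite of the comparison maps differs from the identity of P' by a
    homotopy h, so a cycle z of P' is the boundary of phi y - h z, where y bounds
    the image of z in P. *)
Lemma tens_exact_resolution P P' M N (e : {linear P 0 -> M})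
    (e' : {linear P' 0 -> M}) j :
  proj_resolution e -> proj_resolution e' ->
  tens_exact P N j.+1 -> tens_exact P' N j.+1.
Proof.
move=> Pe P'e PN.
have [phi [phid phie]] := comparison Pe P'e.1.
have [psi [psid psie]] := comparison P'e Pe.1.
have [||h [_ hE]] := null_chain_map
    (phi := fun k => (phi k \o psi k) \- (idfun : {linear P' k -> P' k})) P'e.2 P'e.1.
- by move=> k v; rewrite /= linearB phid psid.
- by move=> v; rewrite /= linearB phie psie subrr.
move=> z; split=> [z0|[y <-]]; last first.
  by rewrite tens_map_compl; apply: tens_map0l => y'; exact: cdifK.
have [y yE] : exists y, tl (cdif P j.+1) y = tl (psi j.+1) z.
  apply/PN; rewrite tens_map_compl.
  have -> : tl (cdif P j \o psi j.+1) z = tl (psi j \o cdif P' j) z.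
    by apply: eq_tens_map => // v; exact: psid.
  by rewrite -tens_map_compl z0 linear0.
exists (tl (phi j.+2) y - tl (h j.+1) z).
pose G : {linear P' j.+1 -> P' j.+1} :=
  (cdif P' j.+1 \o h j.+1) \+ (h j \o cdif P' j).
have E : tl (cdif P' j.+1 \o h j.+1) z + tl (h j \o cdif P' j) z =
    tl (phi j.+1 \o psi j.+1) z - z.
  apply/eqP; rewrite eq_sym subr_eq; apply/eqP.
  have -> : tl (phi j.+1 \o psi j.+1) z = tl G z + tl idfun z.
    apply: tens_map_add => v; apply/eqP; rewrite -subr_eq; apply/eqP/esym.
    exact: hE.
  by rewrite tens_map_id; congr (_ + _); apply: tens_map_add.
have dphi : tl (cdif P' j.+1) (tl (phi j.+2) y) = tl (phi j.+1 \o psi j.+1) z.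
  rewrite -[RHS]tens_map_compl -yE !tens_map_compl.
  by apply: eq_tens_map => // v; exact: phid.
have hd : tl (h j \o cdif P' j) z = 0 by rewrite -tens_map_compl z0 linear0.
rewrite hd addr0 in E.
by rewrite linearB dphi tens_map_compl E opprB addrC subrK.
Qed.

End Comparison.

(** * Projective resolutions of the quotient by the ideal *)

Section QuotientResolution.
Variables (R : comPzRingType) (I : submodClosed R^o) (x : seq R).
Hypothesis Ix : I =i ideal_gen x.
Implicit Types (M : lmodType R) (P : chain R).

Lemma ideal_kill M (m : M) : (forall i : 'I_(size x), x`_i *: m = 0) ->
  forall a, a \in I -> a *: m = 0.
Proof.
move=> xm a; rewrite Ix => /asboolP H.
have fl : linear ((fun r => r *: m) : R^o -> M).
  by move=> b r s; rewrite scalerDl -scalerA.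
have /asboolP : a \in ker_pred (mklin fl); last by [].
apply: H => b /= /(nthP 0)[i ix <-]; apply/asboolP.
exact: (xm (Ordinal ix)).
Qed.

Lemma gen_in_ideal (i : 'I_(size x)) : x`_i \in I.
Proof. by rewrite Ix; apply: span_gen => /=; exact: mem_nth. Qed.

Lemma quotient_kill a (m : (quotmod I : lmodType R)) : a \in I -> a *: m = 0.
Proof.
move=> aI; have [r <-] := quot_proj_surj m.
rewrite -linearZ; apply/quot_projE.
by rewrite -[a *: r]/(a * r) mulrC; exact: (@rpredZ _ _ I r a aI).
Qed.

Lemma quotient_Hom0 P (e : {linear P 0 -> quotmod I}) M : resolution e ->
  Hom_exact P M 0 <-> torsion_free x M.
Proof.
move=> [es e0 eP]; split=> [H m xm|tf f f0].
  have fl : linear ((fun r => r *: m) : R^o -> M).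
    by move=> b r s; rewrite scalerDl -scalerA.
  have [|g gE] := linear_factor (s := quot_proj I) (t := mklin fl) (@quot_proj_surj _ _ I).
    by move=> r /quot_projE rI; exact: ideal_kill.
  have [p pE] := es (quot_proj I 1).
  have := H (g \o e) _ p; rewrite /= pE gE /= scale1r; apply=> y.
  by have -> : e (cdif P 0 y) = 0 by [apply/e0; exists y]; rewrite linear0.
have [|g gE] := linear_factor (t := f) es; first by move=> p /e0[y <-].
have g1 : g (quot_proj I 1) = 0.
  apply: tf => i; rewrite -linearZ quotient_kill ?linear0//.
  exact: gen_in_ideal.
move=> y; rewrite -gE; have [r <-] := quot_proj_surj (e y).
by rewrite -[r]mulr1 -[r * 1]/(r *: (1 : R^o)) !linearZ /= g1 scaler0.
Qed.

Lemma Ext_quotient_depth n M :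
  (forall i, (i < n)%N -> Ext_eq0 i (quotmod I) M) <-> depth_ge x n M.
Proof.
have H P (e : {linear P 0 -> quotmod I}) : proj_resolution e ->
    depth_ge x n M <-> forall i, (i < n)%N -> Hom_exact P M i.
  move=> Pe; apply: depth_Hom_exact; first exact: Pe.2.
    move=> i; apply: (resolution_null_homotopic Pe) => m.
    by rewrite quotient_kill// gen_in_ideal.
  by move=> N; exact: quotient_Hom0 Pe.1.
split=> [EM|Mn i i_n P e Pe]; last by apply: (H P e Pe).1 i i_n.
have [P [e Pe]] := proj_resolution_exists (quotmod I).
by apply/(H P e Pe) => i i_n; exact: EM Pe.
Qed.

End QuotientResolution.

(** * The Koszul complex *)

Section KoszulHomotopy.
Variable R : comPzRingType.
Implicit Types (A B D M N U V : lmodType R) (C P : chain R).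

Lemma tens_map_scale A N (a : R) z :
  tens_map (scale_by A a) (idfun : {linear N -> N}) z = a *: z.
Proof.
apply: (@tens_ext _ _ _ _ _ (scale_by (tens A N) a)) => m n.
by rewrite tens_mapE; exact: (linearZ_LR (mklin (pure_linear_l n))).
Qed.

Lemma pureZl A N (a : R) (m : A) (n : N) : pure (a *: m) n = a *: pure m n.
Proof. exact: (linearZ_LR (mklin (pure_linear_l n))). Qed.

Lemma pureZr A N (a : R) (m : A) (n : N) : pure m (a *: n) = a *: pure m n.
Proof. exact: (linearZ_LR (mklin (pure_linear_r m))). Qed.

Lemma pure_suml A N (T : Type) (s : seq T) (F : T -> A) (n : N) :
  pure (\sum_(t <- s) F t) n = \sum_(t <- s) pure (F t) n.
Proof. exact: (linear_sum (mklin (pure_linear_l n))). Qed.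

Lemma pure_sumr A N (T : Type) (s : seq T) (F : T -> N) (m : A) :
  pure m (\sum_(t <- s) F t) = \sum_(t <- s) pure m (F t).
Proof. exact: (linear_sum (mklin (pure_linear_r m))). Qed.

(** The homotopy sends the part of K (a) (x) C in degree 0 of K (a) to the part in
    degree 1. *)
Lemma two_tens_null_head a C : null_homotopic (two_tens (scale_by R^o a) C) a.
Proof.
pose T := two_tens_obj R^o R^o C.
pose h k : {linear T k -> T k.+1} :=
  match k return {linear T k -> T k.+1} with
  | 0 => pair_lin \0 idfun
  | j.+1 => pair_lin \0 (fst : T j.+1 -> tens R^o (C j.+1))
  end.
have low0 k p : two_tens_low (scale_by R^o a) (0 : tens R^o (C k.+1), p) = a *: p.
  rewrite -[LHS]/(tens_map idfun (cdif C k) 0 + tens_map _ idfun p).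
  by rewrite linear0 add0r tens_map_scale.
exists h; split=> [v|k [p q]]; first exact: low0.
have E : cdif (two_tens (scale_by R^o a) C) k.+1 (h k.+1 (p, q)) =
    (a *: p, - tens_map idfun (cdif C k) p).
  by congr pair; exact: low0.
rewrite E; have -> : h k (cdif (two_tens (scale_by R^o a) C) k (p, q)) =
    (0, tens_map idfun (cdif C k) p + a *: q).
  case: k p q E => [|k] p q _; congr pair;
    exact: congr2 (erefl _) (tens_map_scale _ _).
by congr pair => /=; [rewrite addr0|rewrite addrA addNr add0r].
Qed.

Lemma tens_mapDr A B M (f g : {linear A -> B}) z :
  tens_map (idfun : {linear M -> M}) (f \+ g) z =
  tens_map idfun f z + tens_map idfun g z.
Proof.
apply: (@tens_ext _ _ _ _ _ (tens_map idfun f \+ tens_map idfun g)) => m n.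
rewrite tens_mapE -[RHS]/(tens_map idfun f (pure m n) + tens_map idfun g (pure m n)).
rewrite !tens_mapE; exact: (linearD (mklin (pure_linear_r m))).
Qed.

Lemma tens_map_scaler A M (a : R) z :
  tens_map (idfun : {linear M -> M}) (scale_by A a) z = a *: z.
Proof.
apply: (@tens_ext _ _ _ _ _ (scale_by (tens M A) a)) => m n.
by rewrite tens_mapE; exact: (linearZ_LR (mklin (pure_linear_r m))).
Qed.

(** A homotopy of C acts on the second factor, with the sign of the differential
    on the part in degree 1 of the first. *)
Lemma two_tens_null_tail (f : {linear R^o -> R^o}) C b :
  null_homotopic C b -> null_homotopic (two_tens f C) b.
Proof.
move=> [h [h0 hS]].
pose T := two_tens_obj R^o R^o C.
pose r k := tens_map (idfun : {linear R^o -> R^o}) (h k).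
pose d k := tens_map (idfun : {linear R^o -> R^o}) (cdif C k).
pose t k := tens_map f (idfun : {linear C k -> C k}).
pose H k : {linear T k -> T k.+1} :=
  match k return {linear T k -> T k.+1} with
  | 0 => pair_lin (r 0%N) \0
  | j.+1 => pair_lin (r j.+1 \o (fst : T j.+1 -> tens R^o (C j.+1)))
       (\- (r j \o (snd : T j.+1 -> tens R^o (C j))))
  end.
have dr0 z : d 0%N (r 0%N z) = b *: z.
  by rewrite tens_map_comp -tens_map_scaler; apply: eq_tens_map => // v; exact: h0.
have drS k z : d k.+1 (r k.+1 z) + r k (d k z) = b *: z.
  rewrite !tens_map_comp -tens_map_scaler -tens_mapDr.
  by apply: eq_tens_map => // v; exact: hS.
have tr k z : t k.+1 (r k z) = r k (t k z).
  by rewrite !tens_map_comp; exact: eq_tens_map.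
exists H; split=> [v|k [p q]].
  rewrite -[LHS]/(d 0%N (r 0%N v) + t 0%N 0).
  by rewrite linear0 addr0 dr0.
have F1 : d k.+1 (r k.+1 p) + t k.+1 (- r k q) + r k (d k p + t k q) = b *: p.
  by rewrite linearN tr linearD addrACA addNr addr0 drS.
case: k p q F1 => [|k] p q F1.
  have F2 : - d 0%N (- r 0%N q) + 0 = b *: q by rewrite linearN opprK dr0 addr0.
  by congr pair; [exact: F1|exact: F2].
have F2 : - d k.+1 (- r k.+1 q) - r k (- d k q) = b *: q.
  by rewrite !linearN !opprK drS.
by congr pair; [exact: F1|exact: F2].
Qed.

Lemma koszul_null_homotopic (x : seq R) (i : 'I_(size x)) :
  null_homotopic (koszul x) x`_i.
Proof.
have: x`_i \in x by exact: mem_nth.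
move: (x`_i) => b {i}; elim: x => //= a x IH; rewrite inE => /orP[/eqP->|bx].
  exact: two_tens_null_head.
by apply: two_tens_null_tail; exact: IH.
Qed.

(** The degree 0 term is free on u with coordinate pi, and the image of the
    differential is I u; the second half is stated as: what the generators kill,
    the coordinates of boundaries kill. *)
Lemma koszul_augmentation (x : seq R) :
  exists (u : koszul x 0) (pi : {linear koszul x 0 -> R^o}),
    [/\ pi u = 1, forall v, v = pi v *: u,
        forall b, b \in x -> exists y, cdif (koszul x) 0 y = b *: u &
        forall M (m : M), (forall b, b \in x -> b *: m = 0) ->
          forall y, pi (cdif (koszul x) 0 y) *: m = 0].
Proof.
elim: x => [|a x [u [pi [piu piE ux px]]]].
  exists (1 : R^o), (idfun : {linear R^o -> R^o}); split=> //.
    by move=> v; rewrite -[RHS]/(v * 1) mulr1.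
  by move=> M m _ y; exact: scale0r.
have bl v : linear ((fun r => r * pi v) : R^o -> R^o).
  by move=> c r s; rewrite mulrDl -[c *: r]/(c * r) -mulrA.
have br (r : R^o) : linear ((fun v => r * pi v) : koszul x 0 -> R^o).
  move=> c v w; rewrite linearP mulrDr -[c *: pi v]/(c * pi v).
  by rewrite mulrCA.
pose pi' := tens_lift bl br.
have pi'E r v : pi' (pure r v) = r * pi v by exact: tens_liftE.
have dE p q : cdif (koszul (a :: x)) 0 (p, q) =
    tens_map idfun (cdif (koszul x) 0) p + tens_map (scale_by R^o a) idfun q by [].
exists (pure (1 : R^o) u), pi'; split.
- by rewrite pi'E piu mulr1.
- have sl : linear (fun z : tens R^o (koszul x 0) => pi' z *: pure (1 : R^o) u).
    by move=> c z w; rewrite linearP scalerDl -scalerA.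
  apply: (@tens_ext _ _ _ _ idfun (mklin sl)) => r v.
  rewrite -[LHS]/(pure r v) -[RHS]/(pi' (pure r v) *: pure (1 : R^o) u) pi'E.
  rewrite {1}(piE v) pureZr -!pureZl; congr (pure _ u).
  by rewrite -[LHS]/(pi v * r) -[RHS]/(r * pi v * 1) mulr1 mulrC.
- move=> b; rewrite inE => /orP[/eqP->|/ux[y yE]].
    exists (0, pure (1 : R^o) u); rewrite dE linear0 add0r.
    exact: tens_map_scale.
  exists (pure (1 : R^o) y, 0); rewrite dE linear0 addr0.
  by rewrite tens_mapE yE; exact: pureZr.
move=> M m xm [p q]; rewrite dE linearD scalerDl.
have sl : linear (fun z : tens R^o (koszul x 1) =>
    pi' (tens_map idfun (cdif (koszul x) 0) z) *: m).
  by move=> c z w; rewrite !linearP scalerDl -scalerA.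
have -> : pi' (tens_map idfun (cdif (koszul x) 0) p) *: m = 0.
  apply: (@tens_ext _ _ _ _ (mklin sl) \0) => r y.
  rewrite -[LHS]/(pi' (tens_map idfun (cdif (koszul x) 0) (pure r y)) *: m).
  rewrite tens_mapE pi'E -scalerA px ?scaler0// => b bx.
  by apply: xm; rewrite inE bx orbT.
rewrite tens_map_scale linearZ /= -[a *: _]/(a * _) mulrC -scalerA.
by rewrite xm ?mem_head// scaler0 addr0.
Qed.

Lemma koszul_Hom0 (x : seq R) M : Hom_exact (koszul x) M 0 <-> torsion_free x M.
Proof.
have [u [pi [piu piE ux px]]] := koszul_augmentation x.
split=> [H m xm|tf f f0 y].
  have fl : linear (fun z : koszul x 0 => pi z *: m).
    by move=> c z w; rewrite linearP scalerDl -scalerA.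
  have := H (mklin fl) _ u; rewrite /= piu scale1r; apply.
  by apply: px => b /(nthP 0)[i ix <-]; exact: (xm (Ordinal ix)).
have fu0 : f u = 0.
  apply: tf => i; have [z zE] := ux _ (mem_nth 0 (ltn_ord i)).
  by rewrite -linearZ -zE f0.
by rewrite (piE y) linearZ fu0; exact: scaler0.
Qed.

End KoszulHomotopy.

(** * Dual bases *)

Section DualBasis.
Variable R : comPzRingType.
Implicit Types (A B F M N V : lmodType R).

Definition mkhom A B (f : A -> B) (fl : linear f) : hom A B := Defs.Hom (homP fl).

(** Equivalent to being finitely generated and projective.  In this form it passes
    to tensor products and duals by explicit formulas. *)
Definition dual_basis F := exists s : seq (dual F * F),
  forall v, v = \sum_(p <- s) hom_fun p.1 v *: p.2.

Lemma dual_basis_ring : dual_basis (R^o : lmodType R).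
Proof.
have idl : linear (idfun : R^o -> R^o) by [].
exists [:: (mkhom idl, 1)] => v.
by rewrite big_seq1 -[RHS]/(v * 1) mulr1.
Qed.

Lemma dual_basis_zero F : is_zero F -> dual_basis F.
Proof. by move=> F0; exists [::] => v; rewrite big_nil. Qed.

Lemma dual_basis_prod A B : dual_basis A -> dual_basis B -> dual_basis (A * B)%type.
Proof.
move=> [s sE] [t tE].
pose pr1 : {linear (A * B)%type -> A} := (fst : (A * B)%type -> A).
pose pr2 : {linear (A * B)%type -> B} := (snd : (A * B)%type -> B).
pose in1 : {linear A -> (A * B)%type} := pair_lin idfun \0.
pose in2 : {linear B -> (A * B)%type} := pair_lin \0 idfun.
exists ([seq (dual_map pr1 p.1, in1 p.2) | p <- s] ++
        [seq (dual_map pr2 p.1, in2 p.2) | p <- t]) => v.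
rewrite big_cat !big_map.
have -> : v = in1 v.1 + in2 v.2.
  by case: v => a b; congr pair => /=; rewrite ?addr0 ?add0r.
congr (_ + _).
  by rewrite {1}(sE v.1) linear_sum; apply: eq_bigr => p _; rewrite linearZ /= addr0.
by rewrite {1}(tE v.2) linear_sum; apply: eq_bigr => p _; rewrite linearZ /= add0r.
Qed.

Lemma dual_tens_subproof A B (f : dual A) (g : dual B) :
  exists h : dual (tens A B), forall a b, hom_fun h (pure a b) = hom_fun f a * hom_fun g b.
Proof.
have bl b : linear ((fun a => hom_fun f a * hom_fun g b) : A -> R^o).
  by move=> c u v; rewrite hom_linear mulrDl -[c *: _]/(c * _) -mulrA.
have br a : linear ((fun b => hom_fun f a * hom_fun g b) : B -> R^o).
  by move=> c u v; rewrite hom_linear mulrDr -[c *: _]/(c * _) mulrCA.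
exists (mkhom (linearP (tens_lift bl br))) => a b; exact: tens_liftE.
Qed.

Lemma dual_basis_tens A B : dual_basis A -> dual_basis B -> dual_basis (tens A B).
Proof.
move=> [s sE] [t tE].
have /choice[h hE] (p : dual A * dual B) := dual_tens_subproof p.1 p.2.
exists [seq (h (p.1, q.1), pure p.2 q.2) | p <- s, q <- t] => z.
rewrite big_allpairs_dep /=.
have sl : linear (fun z : tens A B => \sum_(p <- s) \sum_(q <- t)
    hom_fun (h (p.1, q.1)) z *: pure p.2 q.2).
  move=> c u v; rewrite scaler_sumr -big_split; apply: eq_bigr => p _ /=.
  rewrite scaler_sumr -big_split; apply: eq_bigr => q _ /=.
  by rewrite hom_linear scalerDl -scalerA.
apply: (@tens_ext _ _ _ _ idfun (mklin sl)) => a b.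
rewrite -[LHS]/(pure a b) {1}(sE a) pure_suml.
apply: eq_bigr => p _; rewrite {1}(tE b) pure_sumr; apply: eq_bigr => q _.
by rewrite hE pureZl pureZr scalerA.
Qed.

Lemma hom_fun_sum A B (T : Type) (s : seq T) (f : T -> hom A B) v :
  hom_fun (\sum_(t <- s) f t) v = \sum_(t <- s) hom_fun (f t) v.
Proof. by apply: (big_morph (fun h => hom_fun h v)). Qed.

Lemma dual_basis_expand F (s : seq (dual F * F)) :
  (forall v, v = \sum_(p <- s) hom_fun p.1 v *: p.2) ->
  forall g : dual F, g = \sum_(p <- s) hom_fun g p.2 *: p.1.
Proof.
move=> sE g; apply: val_inj; apply/funext => v.
rewrite -[RHS]/(hom_fun _ v) hom_fun_sum {1}(sE v).
rewrite -[LHS]/(mklin (hom_linear g) _) linear_sum; apply: eq_bigr => p _.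
by rewrite linearZ; exact: mulrC.
Qed.

Lemma dual_basis_dual F : dual_basis F -> dual_basis (dual F).
Proof.
move=> [s sE]; have evl v : linear (fun g : dual F => hom_fun g v) by [].
exists [seq (mkhom (evl p.2), p.1) | p <- s] => g.
by rewrite big_map; exact: dual_basis_expand.
Qed.

Lemma dual_basis_projective F : dual_basis F -> projective F.
Proof.
move=> [s sE] M N g f /choice[c cE].
have hl : linear (fun v => \sum_(p <- s) hom_fun p.1 v *: c (f p.2)).
  move=> a u v; rewrite scaler_sumr -big_split; apply: eq_bigr => p _ /=.
  by rewrite hom_linear scalerDl -scalerA.
exists (mklin hl) => v /=; rewrite {2}(sE v) !linear_sum.
by apply: eq_bigr => p _; rewrite !linearZ cE.
Qed.

Lemma dual_basis_fin_gen F : dual_basis F -> fin_gen F.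
Proof.
move=> [s sE]; exists (map snd s) => v; rewrite (sE v) big_seq.
apply: rpred_sum => p ps; apply: rpredZ; apply: span_gen => /=.
exact: map_f.
Qed.

Lemma koszul_dual_basis (x : seq R) k : dual_basis (koszul x k).
Proof.
elim: x k => [|a x IH] [|k] /=.
- exact: dual_basis_ring.
- exact/dual_basis_zero/zero_modP.
- by apply: dual_basis_tens; [exact: dual_basis_ring|exact: IH].
- by apply: dual_basis_prod; apply: dual_basis_tens;
    do ?[exact: dual_basis_ring|exact: IH].
Qed.

(** The natural map F^* (x) M -> Hom (F, M), inverted by a dual basis. *)
Lemma theta_exists F M : exists th : {linear tens (dual F) M -> hom F M},
  forall g m v, hom_fun (th (pure g m)) v = hom_fun g v *: m.
Proof.
have vl (g : dual F) (m : M) : linear (fun v => hom_fun g v *: m).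
  by move=> c u v; rewrite hom_linear scalerDl -scalerA.
have bl m : linear ((fun g => mkhom (vl g m)) : dual F -> hom F M).
  move=> c g h; apply: val_inj; apply/funext => v /=.
  by rewrite -[LHS]/((c * _ + _) *: m) scalerDl -scalerA.
have br g : linear ((fun m => mkhom (vl g m)) : M -> hom F M).
  move=> c m n; apply: val_inj; apply/funext => v /=.
  rewrite -[RHS]/(c *: (hom_fun g v *: m) + hom_fun g v *: n).
  by rewrite scalerDr !scalerA mulrC.
by exists (tens_lift bl br) => g m v; rewrite tens_liftE.
Qed.

Definition theta F M : {linear tens (dual F) M -> hom F M} :=
  sval (cid (theta_exists F M)).

Lemma thetaE F M (g : dual F) (m : M) v :
  hom_fun (theta F M (pure g m)) v = hom_fun g v *: m.
Proof. exact: (svalP (cid (theta_exists F M))). Qed.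

Lemma theta_nat F F' M (u : {linear F' -> F}) z v :
  hom_fun (theta F' M (tens_map (dual_map u) idfun z)) v =
  hom_fun (theta F M z) (u v).
Proof.
have l1 : linear (fun z => hom_fun (theta F' M (tens_map (dual_map u) idfun z)) v).
  by move=> c z1 z2; rewrite !linearP.
have l2 : linear (fun z => hom_fun (theta F M z) (u v)).
  by move=> c z1 z2; rewrite !linearP.
apply: (@tens_ext _ _ _ _ (mklin l1) (mklin l2)) => g m.
rewrite -[LHS]/(hom_fun (theta F' M (tens_map (dual_map u) idfun (pure g m))) v).
by rewrite -[RHS]/(hom_fun (theta F M (pure g m)) (u v)) tens_mapE !thetaE.
Qed.

Lemma theta_inverse F M : dual_basis F ->
  exists k : hom F M -> tens (dual F) M, cancel (theta F M) k /\ cancel k (theta F M).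
Proof.
move=> [s sE]; pose k (h : hom F M) := \sum_(p <- s) pure p.1 (hom_fun h p.2).
have kl : linear k.
  move=> c g h; rewrite /k scaler_sumr -big_split; apply: eq_bigr => p _ /=.
  by rewrite -pure_linear_r.
exists k; split=> [z|h].
  apply: (@tens_ext _ _ _ _ (mklin kl \o theta F M) idfun) => g m.
  rewrite -[RHS]/(pure g m) {2}(dual_basis_expand sE g) pure_suml.
  by apply: eq_bigr => p _; rewrite thetaE pureZl pureZr.
apply: val_inj; apply/funext => v.
rewrite linear_sum -[LHS]/(hom_fun _ v) hom_fun_sum.
rewrite [in RHS](sE v) -[RHS]/(mklin (hom_linear h) _) linear_sum.
by apply: eq_bigr => p _; rewrite thetaE linearZ.
Qed.

End DualBasis.

(** * The truncated dual complex *)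

Section Flip.
Variables (R : comPzRingType) (F : chain R).
Hypothesis Fb : forall k, dual_basis (F k).
Implicit Types (A B C M N : lmodType R).

Local Notation G k := (dual (F k)).
Local Notation delta k := (dual_map (cdif F k)).

(** The complex 0 -> F_0^* -> ... -> F_n^* -> 0 with F_(n-k)^* in degree k.  The
    double recursion makes flip_obj (k + 1) (n + 1) and flip_obj k n convertible,
    so that no cast along an equation between indices occurs. *)
Fixpoint flip_obj k n : lmodType R :=
  match k, n with
  | 0, _ => G n
  | _.+1, 0 => zero_mod R
  | k'.+1, n'.+1 => flip_obj k' n'
  end.

Fixpoint flip_dif k n {struct k} : {linear flip_obj k.+1 n -> flip_obj k n} :=
  match k, n return {linear flip_obj k.+1 n -> flip_obj k n} with
  | 0, 0 => \0
  | 0, n'.+1 => delta n'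
  | _.+1, 0 => \0
  | k'.+1, n'.+1 => flip_dif k' n'
  end.

Fact flip_difK n k v : flip_dif k n (flip_dif k.+1 n v) = 0.
Proof.
elim: k n v => [|k IH] [|n] v //; last exact: IH.
case: n v => [|n] v; first exact: (linear0 (delta 0)).
apply: val_inj; apply/funext => y.
rewrite -[LHS]/(hom_fun (v : G n) (cdif F n (cdif F n.+1 y))) cdifK.
exact: (linear0 (mklin (hom_linear (v : G n)))).
Qed.

Definition flip n : chain R :=
  @Chain R (fun k => flip_obj k n) (fun k => flip_dif k n) (@flip_difK n).

Lemma flip_zero n k : (n < k)%N -> is_zero (flip n k).
Proof.
rewrite /=; elim: k n => [//|k IH] [|n] nk; first exact: zero_modP.
exact: IH.
Qed.

Lemma flip_dual_basis n k : dual_basis (flip n k).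
Proof.
rewrite /=; elim: k n => [|k IH] [|n] /=; do ?exact: dual_basis_dual.
  exact/dual_basis_zero/zero_modP.
exact: IH.
Qed.

Local Notation tl f := (tens_map f idfun).

Lemma theta_inj k M : injective (theta (F k) M).
Proof. by have [g [/can_inj]] := theta_inverse M (Fb k). Qed.

Lemma theta_surj k M (f : {linear F k -> M}) :
  exists z, forall v, hom_fun (theta (F k) M z) v = f v.
Proof.
have [g [_ gK]] := theta_inverse M (Fb k).
by exists (g (mkhom (linearP f))) => v; rewrite gK.
Qed.

Lemma hom_ext A B (g h : hom A B) : hom_fun g =1 hom_fun h -> g = h :> hom A B.
Proof. by move=> gh; apply: val_inj; apply/funext. Qed.

(** Through [theta], the complex F^* (x) M becomes Hom (F, M). *)
Lemma delta_tens_inj M : (forall z, tl (delta 0) z = 0 :> tens _ M -> z = 0) <->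
  Hom_exact F M 0.
Proof.
split=> [H f f0 y|H z z0].
  have [z zE] := theta_surj f; rewrite -zE.
  suff -> : z = 0 by rewrite linear0.
  apply: H; apply: (@theta_inj 1); apply: hom_ext => v.
  by rewrite theta_nat zE f0 linear0.
apply: (@theta_inj 0); rewrite linear0; apply: hom_ext => v.
apply: (H (mklin (hom_linear (theta (F 0) M z)))) => y.
by rewrite /= -theta_nat z0 linear0.
Qed.

Lemma delta_tens_exact M k :
  exact_at (tl (delta k) : {linear tens _ M -> _}) (tl (delta k.+1)) <->
  Hom_exact F M k.+1.
Proof.
split=> [H f f0|H z].
  have [z zE] := theta_surj f.
  have /H[w wE] : tl (delta k.+1) z = 0.
    by apply: theta_inj; apply: hom_ext => v; rewrite theta_nat zE f0 linear0.
  exists (mklin (hom_linear (theta (F k) M w))) => y.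
  by rewrite /= -theta_nat wE zE.
split=> [z0|[w <-]].
  have [|g gE] := H (mklin (hom_linear (theta _ M z))).
    by move=> y; rewrite /= -theta_nat z0 linear0.
  have [w wE] := theta_surj g; exists w; apply: theta_inj; apply: hom_ext => v.
  by rewrite theta_nat wE -gE.
apply: theta_inj; apply: hom_ext => v.
rewrite !theta_nat cdifK linear0.
exact: (linear0 (mklin (hom_linear (theta (F k) M w)))).
Qed.

Lemma zero_tens A M : is_zero A -> is_zero (tens A M).
Proof.
move=> A0 z; apply: (@tens_ext _ _ _ _ idfun \0) => a m.
by rewrite (A0 a); exact: (linear0 (mklin (pure_linear_l m))).
Qed.

Lemma zero_tens_exact (P : chain R) j M : is_zero (P j.+1) -> tens_exact P M j.+1.
Proof.
move=> /(zero_tens (M := M)) P0 z; rewrite (P0 z).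
split=> _; [exists 0|]; exact: linear0.
Qed.

Lemma flip_tens_degree n j M : (j <= n)%N ->
  tens_exact (flip n.+1) M j.+1 <-> Hom_exact F M (n - j).
Proof.
elim: j n => [|j IH] n jn; last by case: n jn => // n; exact: IH.
rewrite subn0; case: n {jn} => [|n]; last exact: delta_tens_exact.
rewrite -delta_tens_inj; split=> [H z /H[w <-]|H z].
  exact: (tens_map0l w (f := \0)).
split=> [/H ->|[w <-]]; first by exists 0; rewrite linear0.
have -> : tl (cdif (flip 1) 1) w = 0 by exact: (tens_map0l w (f := \0)).
exact: linear0.
Qed.

Lemma flip_tens_exact n M :
  (forall j, tens_exact (flip n) M j.+1) <->
  (forall j, (j < n)%N -> Hom_exact F M j).
Proof.
split=> [|H j].
  case: n => // n H j jn; rewrite -(subKn (jn : (j <= n)%N)).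
  by apply/flip_tens_degree; rewrite ?leq_subr.
have [nj|] := leqP n j; first exact/zero_tens_exact/flip_zero.
case: n H => // n H jn; apply/flip_tens_degree => //.
by apply: H; rewrite ltnS leq_subr.
Qed.

(** The isomorphism A (x) R = A is natural. *)
Lemma tens_exact_ring A B C (f : {linear A -> B}) (g : {linear B -> C}) :
  exact_at (tens_map f (idfun : {linear R^o -> R^o})) (tens_map g idfun) ->
  exact_at f g.
Proof.
move=> H.
have bl (D : lmodType R) (r : R^o) : linear ((fun d => r *: d) : D -> D).
  exact: scale_by_linear.
have br (D : lmodType R) (d : D) : linear ((fun r => r *: d) : R^o -> D).
  by move=> b r s; rewrite scalerDl -scalerA.
pose rho (D : lmodType R) := tens_lift (bl D) (br D).
have rhoE (D : lmodType R) (d : D) : rho D (pure d (1 : R^o)) = d.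
  by rewrite tens_liftE scale1r.
have rho_nat (D D' : lmodType R) (h : {linear D -> D'}) z :
    rho D' (tl h z) = h (rho D z).
  apply: (@tens_ext _ _ _ _ (rho D' \o tl h) (h \o rho D)) => d r.
  by rewrite -[LHS]/(rho D' (tl h (pure d r))) -[RHS]/(h (rho D (pure d r)))
    tens_mapE !tens_liftE linearZ.
move=> v; split=> [v0|[u <-]].
  have /H[z zE] : tens_map g idfun (pure v (1 : R^o)) = 0.
    by rewrite tens_mapE v0; exact: (linear0 (mklin (pure_linear_l (1 : R^o)))).
  by exists (rho A z); rewrite -rho_nat zE rhoE.
have : tens_map g idfun (tl f (pure u (1 : R^o))) = 0 by apply/H; exists (pure u (1 : R^o)).
by rewrite !tens_mapE => /(congr1 (rho C)); rewrite rhoE linear0.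
Qed.

Lemma flip_resolution n : (0 < n)%N ->
  (forall j, (j < n)%N -> Hom_exact F R^o j) ->
  exists e : {linear flip n 0 -> coker (dual_map (cdif F n.-1))}, proj_resolution e.
Proof.
case: n => // n _ H; exists (coker_proj (delta n)); split.
  split; first exact: quot_proj_surj.
    exact: coker_proj_exact.
  by move=> k; apply: tens_exact_ring; have /flip_tens_exact := H; apply.
by move=> k; exact/dual_basis_projective/flip_dual_basis.
Qed.

End Flip.

(** * An injective cogenerator *)

Section AdditiveExtension.

(** Euclidean division by the least positive element. *)
Lemma int_subgroup (K : int -> Prop) : (forall a b, K a -> K b -> K (a - b)) ->
  (exists d : nat, [/\ (0 < d)%N, K d & forall k, K k -> exists q, k = q * d%:Z]) \/
  (forall k, K k -> k = 0).
Proof.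
move=> KB; have KN a : K a -> K (- a).
  by move=> Ka; rewrite -sub0r; apply: (KB _ _) => //; rewrite -(subrr a); exact: KB.
have KM a q : K a -> K (q * a).
  have nat_case n : K a -> K (n%:Z * a).
    move=> Ka; elim: n => [|n IH]; first by rewrite mul0r -(subrr a); exact: KB.
    by rewrite intS mulrDl mul1r addrC -[a in _ + a]opprK; apply: (KB _ _) => //; exact: KN.
  move=> Ka; case: q => n; first exact: nat_case.
  by rewrite NegzE mulNr; apply: KN; exact: nat_case.
have [[d d0 Kd]|noK] := pselect (exists2 d : nat, (0 < d)%N & K d); last first.
  right=> -[[|n]|n] Kn //; first by case: noK; exists n.+1.
  by case: noK; exists n.+1 => //; rewrite -[n.+1%:Z]opprK -NegzE; exact: KN.
have ex : exists d : nat, (0 < d)%N && `[< K d >] by exists d; rewrite d0; apply/asboolP.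
case: (ex_minnP ex) => {d0 Kd}d /andP[d0 /asboolP Kd] dmin.
left; exists d; split=> // k Kk; exists (k %/ d)%Z.
have Kr : K (k %% d)%Z by rewrite /modz; apply: (KB _ _) => //; exact: KM.
suff r0 : (k %% d)%Z = 0 by rewrite {1}(divz_eq k d) r0 addr0.
have rge0 : (0 <= (k %% d)%Z)%R by apply: modz_ge0; rewrite eqz_nat -lt0n.
have : ((k %% d)%Z < d%:Z)%R by exact: ltz_pmod.
case: (k %% d)%Z rge0 Kr => // -[//|r] _ Kr; rewrite ltz_nat ltnNge.
by rewrite dmin//=; apply/asboolP.
Qed.

Variable T : zmodType.
Hypothesis T_div : forall (c : T) (d : nat), (0 < d)%N -> exists c', c' *+ d = c.

(** The graph of a homomorphism from a subgroup of N to T; the empty graph is let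
    in, so that unions of arbitrary chains are covered. *)
Definition partial_additive (N : zmodType) (G : set (N * T)) :=
  (forall p q, G p -> G q -> G (p - q)) /\ (forall t, G (0, t) -> t = 0).

(** Zorn's lemma on graphs.  A maximal graph is total: to adjoin n, let d be the
    least positive integer with n d in the domain, and send n to a d-th part of
    the value at n d, or to 0 if there is no such d. *)
Lemma additive_extension (N : zmodType) (G0 : set (N * T)) :
  partial_additive G0 -> G0 (0, 0) ->
  exists f : N -> T, {morph f : x y / x + y} /\ forall n t, G0 (n, t) -> f n = t.
Proof.
move=> pG0 G00.
(* The condition that G contains G0 is only asked of nonempty G, because the
   empty chain has empty union. *)
pose P (G : set (N * T)) :=
  partial_additive G /\ forall p, G p -> (G0 `<=` G)%classic.
have [|A [[[AB A0] AG] Amax]] := @Zorn_bigcup _ P.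
  move=> F FP Ftot; split; first split.
  - move=> p q [X FX Xp] [Y FY Yq].
    have [XY|YX] := Ftot _ _ FX FY.
      by exists Y => //; apply: (FP _ FY).1.1 => //; exact: XY.
    by exists X => //; apply: (FP _ FX).1.1 => //; exact: YX.
  - by move=> t [X FX]; exact: (FP _ FX).1.2.
  - by move=> p [X FX Xp] q G0q; exists X => //; exact: (FP _ FX).2 Xp _ G0q.
have G0A : (G0 `<=` A)%classic.
  have [[p Ap]|Ae] := pselect (exists p, A p); first exact: AG Ap.
  case: (Amax G0 _ (conj pG0 (fun _ _ => @subset_refl _ G0))).
  split=> [p Ap|]; first by case: Ae; exists p.
  by move=> /(_ _ G00) A00; apply: Ae; exists (0, 0).
have A00 : A (0, 0) by exact: G0A.
have AN p : A p -> A (- p) by rewrite -sub0r => Ap; exact: (AB _ _ A00 Ap).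
have AD p q : A p -> A q -> A (p + q).
  by move=> Ap Aq; rewrite -[q]opprK; apply: (AB _ _) => //; exact: AN.
have AM n t q : A (n, t) -> A (n *~ q, t *~ q).
  have nat_case k : A (n, t) -> A (n *+ k, t *+ k).
    by move=> Ap; elim: k => [//|k IH]; rewrite !mulrS; exact: (AD _ _ Ap IH).
  move=> Ap; case: q => k; first exact: nat_case.
  by rewrite NegzE !mulrNz; apply: (AN (_, _)); exact: nat_case.
have Afun n t t' : A (n, t) -> A (n, t') -> t = t'.
  move=> nt nt'; apply/subr0_eq/A0; rewrite -(subrr n).
  exact: (AB _ _ nt nt').
have Atot n : exists t, A (n, t).
  apply: contrapT => nA.
  have [c cE] : exists c, forall k t, A (n *~ k, t) -> t = c *~ k.
    have [|[d [d0 [td Atd] dK]]|K0] := int_subgroup (K := fun k => exists t, A (n *~ k, t)).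
    - move=> a b [t At] [s As]; exists (t - s); rewrite mulrzBr.
      exact: (AB _ _ At As).
    - have [c cd] := T_div td d0; exists c => k t Ak.
      have [|q kE] := dK k; first by exists t.
      apply: (Afun (n *~ k)) => //.
      rewrite kE mulrC !mulrzA -[c *~ d]/(c *+ d) cd.
      exact: AM.
    - exists 0 => k t Ak; rewrite mul0rz; apply: A0.
      by have k0 := K0 k (ex_intro _ t Ak); rewrite k0 in Ak.
  pose B : set (N * T) :=
    (fun p => exists y t k, A (y, t) /\ p = (y + n *~ k, t + c *~ k)).
  suff PB : P B.
    case: (Amax B _ PB).
    split=> [[y t] Ayt|BA]; first by exists y, t, 0; rewrite !mulr0z !addr0.
    apply: nA; exists c; apply: BA; exists 0, 0, 1; split=> //.
    by rewrite !mulr1z !add0r.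
  split.
    split.
      move=> _ _ [y [t [k [Ay ->]]]] [y' [t' [k' [Ay' ->]]]].
      exists (y - y'), (t - t'), (k - k'); split; first exact: (AB _ _ Ay Ay').
      by congr pair; rewrite /= mulrzBr opprD addrACA.
    move=> s [y [t [k [Ay []]]]] /esym/eqP; rewrite addr_eq0 => /eqP yE ->.
    have At : A (n *~ k, - t).
      by have := AN _ Ay; rewrite -[- (y, t)]/(- y, - t) yE opprK.
    by rewrite -(cE _ _ At) subrr.
  move=> _ _ p /G0A Ap; case: p Ap => y t Ap.
  by exists y, t, 0; rewrite !mulr0z !addr0.
have [f fA] := choice Atot.
exists f; split=> [y z|n t G0n]; last by apply: (Afun n) => //; exact: G0A.
by apply: (Afun (y + z)) => //; exact: (AD _ _ (fA y) (fA z)).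
Qed.

End AdditiveExtension.

Section QmodZ.

Definition int_rat : {pred rat} := fun q => `[< exists z : int, q = z%:~R >].

Fact int_rat_closed : zmod_closed int_rat.
Proof.
split; first by apply/asboolP; exists 0.
by move=> _ _ /asboolP[a ->] /asboolP[b ->]; apply/asboolP; exists (a - b); rewrite rmorphB.
Qed.
HB.instance Definition _ := GRing.isZmodClosed.Build rat int_rat int_rat_closed.

Definition QmodZ : zmodType := Quotient.quot int_rat.

Definition QmodZ_class (q : rat) : QmodZ := (\pi_(Quotient.quot int_rat) q)%qT.

Lemma QmodZ_classM q n : QmodZ_class (q *+ n) = QmodZ_class q *+ n.
Proof. exact: raddfMn. Qed.

Lemma QmodZ_class0 q : QmodZ_class q = 0 <-> exists z : int, q = z%:~R.
Proof.
have -> : 0 = QmodZ_class 0 by apply/esym; exact: raddf0.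
split=> [/eqP|[z qz]]; last apply/eqP.
  by rewrite -Quotient.idealrBE subr0 => /asboolP.
by rewrite -Quotient.idealrBE subr0; apply/asboolP; exists z.
Qed.

Lemma QmodZ_div (c : QmodZ) (d : nat) : (0 < d)%N -> exists c', c' *+ d = c.
Proof.
move=> d0; exists (QmodZ_class (repr (c : Quotient.quot int_rat) / d%:R)).
rewrite -QmodZ_classM -[X in QmodZ_class X]mulr_natr divfK; last by rewrite Num.Theory.pnatr_eq0 -lt0n.
exact: reprK.
Qed.

Lemma QmodZ_torsion d : (1 < d)%N -> exists c : QmodZ, c <> 0 /\ c *+ d = 0.
Proof.
move=> d1; have d0 : d%:R != 0 :> rat by rewrite Num.Theory.pnatr_eq0 -lt0n ltnW.
exists (QmodZ_class d%:R^-1); split.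
  move=> /QmodZ_class0[z dz].
  have : (z * d%:Z)%:~R = 1 :> rat by rewrite intrM -dz mulVf.
  move=> /eqP; rewrite -[1]/(1%:~R) eqr_int => /eqP zd.
  by have := congr1 absz zd; rewrite abszM /= => /eqP; rewrite muln_eq1 => /andP[_ /eqP dd]; rewrite dd in d1.
rewrite -QmodZ_classM -[X in QmodZ_class X]mulr_natr mulVf//; apply/QmodZ_class0.
by exists 1.
Qed.

End QmodZ.

(** The characters of the additive group of R.  Linear maps N -> Hom_Z (R, Q/Z)
    correspond to additive maps N -> Q/Z by evaluation at 1, so the module of
    characters inherits injectivity and cogeneration from Q/Z. *)
Section Characters.
Variable R : comPzRingType.

Definition additive_pred : {pred R -> QmodZ} :=
  fun f => `[< {morph f : x y / x + y} >].

Fact additive_pred_closed : zmod_closed additive_pred.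
Proof.
split; first by apply/asboolP => x y; rewrite -[RHS]/(0 + 0 : QmodZ) addr0.
move=> f g /asboolP fD /asboolP gD; apply/asboolP => x y.
rewrite -[LHS]/(f (x + y) - g (x + y)) fD gD opprD addrACA.
by [].
Qed.
HB.instance Definition _ :=
  GRing.isZmodClosed.Build (R -> QmodZ) additive_pred additive_pred_closed.

Record character := Character {
  char_fun : R -> QmodZ; _ : char_fun \in additive_pred }.

HB.instance Definition _ := [isSub for char_fun].
HB.instance Definition _ := [Choice of character by <:].
HB.instance Definition _ := [SubChoice_isSubZmodule of character by <:].

Lemma char_funD (f : character) : {morph char_fun f : x y / x + y}.
Proof. exact/asboolP/(valP f). Qed.

Definition mkchar (f : R -> QmodZ) (fD : {morph f : x y / x + y}) : character :=
  Character (introT (asboolP _) fD : f \in additive_pred).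

Fact char_scale_subproof (a : R) (f : character) :
  {morph (fun r => char_fun f (r * a)) : x y / x + y}.
Proof. by move=> x y; rewrite mulrDl char_funD. Qed.

Definition char_scale a f := mkchar (char_scale_subproof a f).

Lemma char_ext (f g : character) : char_fun f =1 char_fun g -> f = g.
Proof. by move=> fg; apply: val_inj; apply/funext. Qed.

Fact char_scaleA a b f : char_scale a (char_scale b f) = char_scale (a * b) f.
Proof. by apply: char_ext => r /=; rewrite mulrA. Qed.

Fact char_scale1 : left_id 1 char_scale.
Proof. by move=> f; apply: char_ext => r /=; rewrite mulr1. Qed.

Fact char_scaleDr : right_distributive char_scale +%R.
Proof. by move=> a f g; apply: char_ext. Qed.

Fact char_scaleDl f : {morph char_scale^~ f : a b / a + b}.
Proof.
move=> a b; apply: char_ext => r /=; rewrite mulrDr char_funD.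
by [].
Qed.

HB.instance Definition _ := GRing.Zmodule_isLmodule.Build R character
  char_scaleA char_scale1 char_scaleDr char_scaleDl.

Lemma char_lift (N : lmodType R) (h : N -> QmodZ) : {morph h : x y / x + y} ->
  exists k : {linear N -> character}, forall n r, char_fun (k n) r = h (r *: n).
Proof.
move=> hD; have nD n : {morph (fun r => h (r *: n)) : x y / x + y}.
  by move=> x y; rewrite scalerDl hD.
have kl : linear (fun n => mkchar (nD n)).
  move=> a u v; apply: char_ext => r.
  rewrite -[RHS]/(h ((r * a) *: u) + h (r *: v)) -hD.
  by rewrite -scalerA -scalerDr.
by exists (mklin kl).
Qed.

Lemma character_injective : injective_mod character.
Proof.
move=> M N g f gi.
have fD : {morph (fun m => char_fun (f m) 1) : x y / x + y}.
  by move=> x y; rewrite linearD.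
have fB x y : char_fun (f (x - y)) 1 = char_fun (f x) 1 - char_fun (f y) 1.
  by rewrite linearB.
pose G0 : set (N * QmodZ) := (fun p => exists m, p = (g m, char_fun (f m) 1)).
have [||h [hD hG]] := additive_extension QmodZ_div (G0 := G0).
- split=> [_ _ [m ->] [m' ->]|t [m [/esym gm ->]]].
    by exists (m - m'); rewrite linearB fB.
  have -> : m = 0 by apply: gi; rewrite gm linear0.
  by rewrite linear0.
- by exists 0; rewrite !linear0.
have [k kE] := char_lift hD; exists k => m; apply: char_ext => r.
rewrite kE -linearZ (hG _ (char_fun (f (r *: m)) 1)); last by exists (r *: m).
by rewrite linearZ -[LHS]/(char_fun (f m) (1 * r)) mul1r.
Qed.

Lemma character_cogenerator : cogenerator character.
Proof.
move=> M N f [x fx0].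
(* c is the value to be taken at f x: nonzero, of order dividing that of f x. *)
have [c [c0 cf]] : exists c : QmodZ, c <> 0 /\ forall k : int, f x *~ k = 0 -> c *~ k = 0.
  have [|[d [d0 fd dK]]|K0] := int_subgroup (K := fun k => f x *~ k = 0).
  - by move=> a b fa fb; rewrite mulrzBr fa fb subrr.
  - have [|c [c0 cd]] := @QmodZ_torsion d.
      by case: d d0 fd {dK} => [|[|d]] //=.
    exists c; split=> // k /dK[q ->].
    by rewrite mulrC mulrzA -[c *~ d]/(c *+ d) cd mul0rz.
  - have [c [c0 _]] := @QmodZ_torsion 2 isT; exists c; split=> // k /K0 ->.
    by rewrite mulr0z.
pose G0 : set (N * QmodZ) := (fun p => exists k : int, p = (f x *~ k, c *~ k)).
have [||h [hD hG]] := additive_extension QmodZ_div (G0 := G0).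
- split=> [_ _ [k ->] [k' ->]|t [k [/esym fk ->]]]; last exact: cf.
  by exists (k - k'); rewrite !mulrzBr.
- by exists 0; rewrite !mulr0z.
have [k kE] := char_lift hD; exists k, x => /(congr1 (fun w => char_fun w 1)).
rewrite kE scale1r (hG _ c); first exact: c0.
by exists 1; rewrite !mulr1z.
Qed.

End Characters.

(** * The cokernel of the dual Koszul differential *)

Section KoszulCoker.
Variables (R : comPzRingType) (n : nat) (x : seq R).
Hypotheses (n_gt0 : (0 < n)%N) (Rn : depth_ge x n R^o).
Implicit Types M : lmodType R.

Lemma koszul_depth M k : depth_ge x k M <->
  forall j, (j < k)%N -> Hom_exact (koszul x) M j.
Proof.
apply: depth_Hom_exact.
- by move=> j; exact/dual_basis_projective/koszul_dual_basis.
- exact: koszul_null_homotopic.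
- exact: koszul_Hom0.
Qed.

Local Notation S := (koszul_coker x n).
Local Notation P := (flip (koszul x) n).

Lemma koszul_coker_resolution : exists e : {linear P 0 -> S}, proj_resolution e.
Proof.
apply: flip_resolution => //; first exact: koszul_dual_basis.
exact/koszul_depth.
Qed.

Lemma koszul_coker_fp : strongly_fp S.
Proof.
have [e Pe] := koszul_coker_resolution; exists P, e; split=> //.
  by move=> k; exact/dual_basis_fin_gen/flip_dual_basis/koszul_dual_basis.
by exists n => k; exact: flip_zero.
Qed.

Lemma koszul_coker_projdim : projdim_le S n.
Proof.
have [e Pe] := koszul_coker_resolution; exists P, e; split=> // k.
exact: flip_zero.
Qed.

Lemma Tor_koszul_coker M :
  depth_ge x n M <-> forall i, (0 < i)%N -> Tor_eq0 i S M.
Proof.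
have [e Pe] := koszul_coker_resolution.
rewrite koszul_depth -(flip_tens_exact (@koszul_dual_basis _ x)).
split=> [H [//|i] _ P' e' P'e|H i]; last exact: H Pe.
exact: tens_exact_resolution Pe P'e (H i).
Qed.

(** A resolution of length k < n computes Tor_n (S, M) = 0, and Tor_n (S, M) is the
    submodule of the elements of M that I kills. *)
Lemma projdim_torsion_free M k : (k < n)%N -> projdim_le S k -> torsion_free x M.
Proof.
move=> kn [P' [e' [P'e P'0]]]; have [e Pe] := koszul_coker_resolution.
have : tens_exact P M n.-1.+1.
  apply: tens_exact_resolution P'e Pe _; apply: zero_tens_exact.
  by apply: P'0; rewrite prednK.
case: n n_gt0 => // m _.
by move=> /(flip_tens_degree (@koszul_dual_basis _ x) _ (leqnn m));
  rewrite subnn => /koszul_Hom0.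
Qed.

End KoszulCoker.

Theorem proposition5p12 (R : comPzRingType) (n : nat) (n_gt0 : (0 < n)%N)
    (I : submodClosed R^o) (x : seq R) (Ix : I =i ideal_gen x)
    (extR : forall i, (i < n)%N -> Ext_eq0 i (quotmod I) R^o) :
  [/\ strongly_fp (koszul_coker x n),
      projdim_le (koszul_coker x n) n &
      1 \notin I -> projdim_eq (koszul_coker x n) n] /\
  (forall M : lmodType R,
      (forall i, (i < n)%N -> Ext_eq0 i (quotmod I) M) <->
      (forall i, (0 < i)%N -> Tor_eq0 i (koszul_coker x n) M)) /\
  (let K := fun M : lmodType R =>
     forall i, (i < n)%N -> Ext_eq0 i (quotmod I) M in
   cotilting_class n K /\ cofinite_type K).
Proof.
have Rn : depth_ge x n R^o by apply/(Ext_quotient_depth Ix).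
have Tor_iff M : (forall i, (i < n)%N -> Ext_eq0 i (quotmod I) M) <->
    (forall i, (0 < i)%N -> Tor_eq0 i (koszul_coker x n) M).
  by rewrite (Ext_quotient_depth Ix) (Tor_koszul_coker n_gt0 Rn).
have Sfp := koszul_coker_fp n_gt0 Rn.
have Spd := koszul_coker_projdim n_gt0 Rn.
split; [split=> // I1; split=> // k kn Sk|split=> [//|K]].
  (* 1 in R/I is killed by I, so it is 0 if R/I is torsion-free. *)
  have tf : torsion_free x (quotmod I) by exact: projdim_torsion_free kn Sk.
  move/negP: I1; apply; apply/quot_projE/tf => i; rewrite -linearZ.
  by apply/quot_projE; rewrite -[_ *: _]/(_ * 1) mulr1; exact: gen_in_ideal.
have Kp k : projective (koszul x k).
  exact/dual_basis_projective/koszul_dual_basis.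
have Wi := @character_injective R; have Wc := @character_cogenerator R.
have Kx := @koszul_null_homotopic R x; have K0 := @koszul_Hom0 R x.
split.
  exists (cotilt x n (character R)); split.
    exact: (cotilt_cotilting Wi Wc Kp Kx K0).
  move=> M; rewrite /K (Ext_quotient_depth Ix).
  apply: (cotilt_class Wi Wc Kp Kx K0) => k kn.
  exact: (counit_surj Wi Rn kn).
exists unit, (fun=> koszul_coker x n), n; split=> // M.
by rewrite /K Tor_iff; split=> [H _|H]; [exact: H|exact: (H tt)].
Qed.
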